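(* Let $k\ge1$, $\mathbf d\in(\mathbb Z_{\ge0})^k$ and $\mathbf a\in(\mathbb Z_{\ge0})^k$ with $\mathbf a_i\le\mathbf d_i$ for all $i$. Then $\mathbf 1_{Y_{\mathbf a}}$ is the unique element of $\mathcal T_s(\mathbf d)$ that is equal to one on the dense points of the irreducible component $\overline{Z_{\mathbf a}}$ of $\mathfrak T(\mathbf d)$ and has support contained in this irreducible component.
   Context: $\mathbb F$ is a finite field with $q^2$ elements; functions take values in $\mathbb C(q)$, spans are $\mathbb C(q)$-spans, and the support of $f$ is $\{x: f(x)\ne0\}$. $\mathbf 1_Y$ is the indicator function of $Y$. **Tensor product variety.** Let $d=\sum_i\mathbf d_i$ and $D$ a $d$-dimensional $\mathbb F$-space. $\mathfrak T(\mathbf d)$ is the set of triples $(\mathbf D,W,t)$, where $\mathbf D=(0=\mathbf D_0\subset\cdots\subset\mathbf D_k=D)$ is a flag with $\dim\mathbf D_i/\mathbf D_{i-1}=\mathbf d_i$, $W\subset D$ is a subspace, $t\in\mathrm{End}\,D$, $t(\mathbf D_i)\subset\mathbf D_{i-1}$ and $\operatorname{im}t\subset W\subset\ker t$. For a subspace $X\subset D$, $\alpha(X,\mathbf D)_i=\dim(X\cap\mathbf D_i)/(X\cap\mathbf D_{i-1})$, and $\alpha(t,\mathbf D):=\alpha(\ker t,\mathbf D)$. Let $A_{\mathbf w,\mathbf r,\mathbf n}=\{(\mathbf D,W,t)\in\mathfrak T(\mathbf d):\alpha(W,\mathbf D)=\mathbf w,\ \alpha(\operatorname{im}t,\mathbf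 D)=\mathbf r,\ \alpha(\ker t,\mathbf D)=\mathbf n\}$; $\mathcal T(\mathbf d)$ is the span of the functions $\mathbf 1_{A_{\mathbf w,\mathbf r,\mathbf n}}$. $\mathcal T_s(\mathbf d)$ is the space of all $f\in\mathcal T(\mathbf d)$ such that $f(\mathbf D,W,t)=f(\mathbf D',W',t')$ whenever $\dim W=\dim W'$ and $\alpha(t,\mathbf D)=\alpha(t',\mathbf D')$. **Lower crossingless matches.** Place $k$ boxes from left to right, box $i$ having $\mathbf d_i$ vertices. $M(\mathbf d,\mathbf a)$ is the collection of arcs obtained by marking the rightmost $\mathbf a_i$ vertices of box $i$ down and the others up, and then, going from right to left, joining each down vertex to the first unmatched up vertex to its right, if any. For $M=M(\mathbf d,\mathbf a)$, $\mathbf r^M_i$ is the number of left endpoints of arcs in box $i$ and $\mathbf n^M_i$ is $\mathbf d_i$ minus the number of right endpoints of arcs in box $i$. Set $Y_{\mathbf a}=\{(\mathbf D,W,t)\in\mathfrak T(\mathbf d):\alpha(t,\mathbf D)=\mathbf n^{M(\mathbf d,\mathbf a)},\ \dim W=\sum_i\mathbf a_i\}$. **Irreducible components.** Let $\mathfrak T(\mathbf d)'$ be the corresponding variety over $\overline{\mathbb F}$ and $Z'_{\mathbf a}=\{(\mathbf D,W,t)\in\mathfrak T(\mathbf d)':\alpha(W,\mathbf D)=\mathbf a\}$; the irreducible components of $\mathfrak T(\mathbf d)'$ are the Zariski closures $\overline{Z'_{\mathbf a}}$, $0\le\mathbf a_i\le\mathbf d_i$. The irreducible component $\overline{Z_{\mathbf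 a}}$ of $\mathfrak T(\mathbf d)$ is the set of $\mathbb F$-points of $\overline{Z'_{\mathbf a}}$; its dense points are the points of $A_{\mathbf a,\mathbf r^M,\mathbf n^M}$ with $M=M(\mathbf d,\mathbf a)$. *)

(* Defs.v *)
From HB Require Import structures.
From mathcomp Require Import all_boot all_order all_algebra.
From mathcomp Require Import complex.
From mathcomp Require Import mpoly.
From mathcomp Require Import reals.

Set Implicit Arguments.
Unset Strict Implicit.
Unset Printing Implicit Defensive.

Import GRing.Theory.
Local Open Scope ring_scope.

(* The field C(q) of rational functions in q over the complex numbers. *)
Definition Cq (R : realType) : fieldType := {fraction {poly R[i]}}.

Section TensorVariety.
Variables (E : fieldType) (V : vectType E) (k : nat).

(* A filtration D_0, ..., D_k; for the step i : 'I_k (numbered from 0),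
   [below D i] and [upto D i] are the two consecutive terms of index i, i.+1. *)
Definition filtration := {ffun 'I_k.+1 -> {vspace V}}.
Definition below (D : filtration) (i : 'I_k) := D (widen_ord (leqnSn k) i).
Definition upto (D : filtration) (i : 'I_k) := D (lift ord0 i).

Definition is_flag (d : {ffun 'I_k -> nat}) (D : filtration) : bool :=
  [&& D ord0 == 0%VS, D ord_max == fullv,
      [forall i, (below D i <= upto D i)%VS] &
      [forall i, \dim (upto D i) == (\dim (below D i) + d i)%N]].

Record tpv (d : {ffun 'I_k -> nat}) := TPV {
  flag : filtration;
  mid : {vspace V};
  endo : 'End(V);
  flagP : is_flag d flag;
  endo_flag : [forall i, (endo @: upto flag i <= below flag i)%VS];
  mid_endo : (limg endo <= mid)%VS && (mid <= lker endo)%VS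
}.

Definition alpha (X : {vspace V}) (D : filtration) : {ffun 'I_k -> nat} :=
  [ffun i => (\dim (X :&: upto D i) - \dim (X :&: below D i))%N].

Variable d : {ffun 'I_k -> nat}.

Definition strat (w r n : {ffun 'I_k -> nat}) : pred (tpv d) := fun x =>
  [&& alpha (mid x) (flag x) == w,
      alpha (limg (endo x)) (flag x) == r &
      alpha (lker (endo x)) (flag x) == n].

End TensorVariety.

Definition indicator (T : Type) (L : fieldType) (Y : pred T) : T -> L :=
  fun x => (Y x)%:R.

Section FunctionSpaces.
Variables (L : fieldType) (F : fieldType) (V : vectType F) (k : nat).
Variable d : {ffun 'I_k -> nat}.
Local Notation comp := {ffun 'I_k -> nat}.

(* The span of the indicator functions of the sets [strat w r n]. *)
Definition Tspace (f : tpv V d -> L) : Prop :=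
  exists s : seq (L * (comp * comp * comp)), forall x,
    f x = \sum_(p <- s) p.1 * indicator L (strat p.2.1.1 p.2.1.2 p.2.2) x.

Definition Tspace_s (f : tpv V d -> L) : Prop :=
  Tspace f /\
  forall x x' : tpv V d,
    \dim (mid x) = \dim (mid x') ->
    alpha (lker (endo x)) (flag x) = alpha (lker (endo x')) (flag x') ->
    f x = f x'.

End FunctionSpaces.

Section Matches.
Variables (k : nat) (d a : {ffun 'I_k -> nat}).

(* The vertex (i, j) is the j-th vertex from the left of box i, from 0. *)
Definition vertex : Type := 'I_k * nat.

Definition vertices : seq vertex :=
  [seq (i, j) | i <- enum 'I_k, j <- iota 0 (d i)].

Definition down (v : vertex) : bool := (d v.1 - a v.1 <= v.2)%N.

(* The vertices are read from right to left; the state consists of the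
   unmatched up vertices read so far, from left to right, and of the arcs
   (left endpoint, right endpoint) drawn so far. *)
Definition match_step (v : vertex) (st : seq vertex * seq (vertex * vertex)) :=
  if down v then
    if st.1 is u :: free then (free, (v, u) :: st.2) else st
  else (v :: st.1, st.2).

Definition lcmatch : seq (vertex * vertex) :=
  (foldr match_step ([::], [::]) vertices).2.

Definition match_r : {ffun 'I_k -> nat} :=
  [ffun i => count (fun e : vertex * vertex => e.1.1 == i) lcmatch].

Definition match_n : {ffun 'I_k -> nat} :=
  [ffun i => (d i - count (fun e : vertex * vertex => e.2.1 == i) lcmatch)%N].

End Matches.

Section Zariski.
Variables (K : fieldType) (n k : nat) (d : {ffun 'I_k -> nat}).
Local Notation T := (tpv 'rV[K]_n d).

Definition rows_of m (B : 'M[K]_(m, n)) : seq 'rV[K]_n :=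
  [seq row j B | j <- enum 'I_m].

(* Homogeneous coordinates of a point (D, W, t): an invertible matrix g whose
   first rows span the successive D_i, and a matrix B whose rows form a basis
   of W. *)
Definition coordinates (x : T) (g : 'M[K]_n) m (B : 'M[K]_(m, n)) : Prop :=
  [/\ g \in unitmx,
      forall i : 'I_k.+1,
        flag x i = <<take (\dim (flag x i)) (rows_of g)>>%VS &
      basis_of (mid x) (rows_of B)].

(* All the entries of g, B and of the matrix of t, as a point of affine space *)
Definition affine_point (x : T) (g : 'M[K]_n) m (B : 'M[K]_(m, n)) :
    'rV[K]_((n + (m + n)) * n) :=
  mxvec (col_mx g (col_mx B (lin1_mx (endo x)))).

(* The variety is a subvariety of the disjoint union over m of the products
   Fl x Gr_m x End, where the flag variety Fl = GL_n / P and the Grassmannian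
   Gr_m = {m x n matrices of rank m} / GL_m carry the quotient of the Zariski
   topology on matrices: a set is closed iff, for every m, the homogeneous
   coordinates of its points with dim W = m are cut out by polynomials. *)
Definition zariski_closed (C : T -> Prop) : Prop :=
  forall m : nat, exists S : {mpoly K[(n + (m + n)) * n]} -> Prop,
    forall (x : T) (g : 'M[K]_n) (B : 'M[K]_(m, n)), coordinates x g B ->
      (C x <-> forall p, S p -> p.@[affine_point x g B 0] = 0).

Definition zariski_closure (A : T -> Prop) (x : T) : Prop :=
  forall C : T -> Prop, zariski_closed C -> (forall y, A y -> C y) -> C x.

Definition Zcell (a : {ffun 'I_k -> nat}) (x : T) : Prop :=
  alpha (mid x) (flag x) = a.

End Zariski.

(* Extension of scalars along iota : F -> K, where the extension of V is
   identified with a coordinate space by means of the basis [vbasis fullv]. *)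
Section BaseChange.
Variables (F K : fieldType) (iota : {rmorphism F -> K}) (V : vectType F).
Local Notation VK := 'rV[K]_(\dim {:V}).

Definition ext_vec (v : V) : VK :=
  \row_i iota (coord (vbasis {:V}) i v).

Definition ext_sub (U : {vspace V}) : {vspace VK} :=
  <<[seq ext_vec v | v <- vbasis U]>>%VS.

Definition ext_point k (d : {ffun 'I_k -> nat}) (x : tpv V d) (y : tpv VK d) :
    Prop :=
  [/\ forall i, flag y i = ext_sub (flag x i),
      mid y = ext_sub (mid x) &
      forall v, endo y (ext_vec v) = ext_vec (endo x v)].

End BaseChange.

Section Component.
Variables (F : fieldType) (V : vectType F) (k : nat) (d a : {ffun 'I_k -> nat}).

Definition Zcomponent (K : fieldType) (iota : {rmorphism F -> K})
    (x : tpv V d) : Prop :=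
  exists2 y, ext_point iota x y & zariski_closure (Zcell a) y.

Definition dense_point : pred (tpv V d) :=
  strat a (match_r d a) (match_n d a).

Definition Yset : pred (tpv V d) := fun x =>
  (alpha (lker (endo x)) (flag x) == match_n d a) &&
  (\dim (mid x) == \sum_i a i)%N.

End Component.

(* Main.v *)
Require Import Defs.
From mathcomp Require Import all_boot all_order all_algebra.
From mathcomp Require Import reals.
From mathcomp Require Import mpoly zify.

(* Existence.  Let [x] be a point of [Y_a].  A basis adapted to its flag and to
   [ker t] yields a point [x1] of [Z_a] with the same flag and the same kernel.
   On the pencil through [x] and [x1] the ranks which are maximal at [x1] are
   maximal at all but finitely many points, and maximality of the dimensions of
   [W + D_i] and [t D_q + D_p] forces the type of [W] to be [a]; hence [x] is in
   the closure of [Z_a].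

   Uniqueness.  Every pair (dim W, type of [ker t]) that occurs is the pair of
   the dense points of some [a'], since turning the leftmost unmatched down vertex
   up does not affect the arcs.  If dense points of [a'] lie in the closure of
   [Z_a], then [a'] dominates [a], and for all [p < q] the rank of
   [t : D_q -> D / D_p], which counts the arcs of [a'] between the boxes [p] and
   [q], is bounded by the corresponding cuts of [a].  On a maximal interval where
   the partial sums of [a'] exceed those of [a] the cuts of [a'] exceed those of
   [a], and one cut of [a'] is at most the number of arcs; so [a' = a]. *)

Set Implicit Arguments.
Unset Strict Implicit.
Unset Printing Implicit Defensive.

Import GRing.Theory passmx.
Local Open Scope ring_scope.

(** * Crossingless matches *)

Section Combinatorics.
Local Open Scope nat_scope.
Variables (k : nat).
Implicit Types (f g d a n u : {ffun 'I_k -> nat}) (s : seq (vertex k)).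

(** Compositions are compared through partial sums, indexed by [nat] for induction; those of the
    type of [X] along a flag are the dimensions of the intersections of [X] with its terms. *)
Definition psum f (i : nat) := \sum_(l < k | l < i) f l.

Lemma psum0 f : psum f 0 = 0.
Proof. by rewrite /psum big_pred0. Qed.

Lemma psumS f (i : 'I_k) : psum f i.+1 = psum f i + f i.
Proof.
rewrite /psum (bigD1 i) ?ltnS //= addnC; congr (_ + _).
by apply: eq_bigl => l; rewrite ltnS ltn_neqAle andbC.
Qed.

Lemma psum_full f i : k <= i -> psum f i = \sum_l f l.
Proof. by move=> ki; apply: eq_bigl => l; rewrite (leq_trans (ltn_ord l)). Qed.

Lemma psum_mono f i j : i <= j -> psum f i <= psum f j.
Proof.
move=> ij; rewrite /psum [leqRHS](bigID (fun l : 'I_k => l < i)) /=.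
rewrite -[leqLHS]addn0 leq_add //; apply: eq_leq; apply: eq_bigl => l.
by case: ltnP => [/leq_trans->//|]; rewrite andbF.
Qed.

Lemma sum_range f p q : p <= q ->
  \sum_(i < k | p <= i < q) f i = psum f q - psum f p.
Proof.
move=> pq; rewrite /psum [in RHS](bigID (fun l : 'I_k => l < p)) /=.
rewrite [X in _ = X + _ - _](eq_bigl (fun l : 'I_k => l < p)); last first.
  by move=> l; lia.
by rewrite addKn; apply: eq_bigl => l; lia.
Qed.

Lemma leq_psum f g : (forall l, f l <= g l) ->
  forall i j, i <= j -> psum f j - psum f i <= psum g j - psum g i.
Proof. by move=> fg i j ij; rewrite -!sum_range //; apply: leq_sum. Qed.

Lemma eq_psum f g : (forall i, i <= k -> psum f i = psum g i) -> f = g.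
Proof.
move=> fg; apply/ffunP => l; have := fg l.+1 (ltn_ord l).
by rewrite !psumS (fg l (ltnW (ltn_ord l))) => /addnI.
Qed.

Lemma count_vertices d (P : pred (vertex k)) :
  count P (vertices d) = \sum_i count (fun j => P (i, j)) (iota 0 (d i)).
Proof.
rewrite /vertices count_flatten -map_comp sumnE big_map -big_enum /=.
by apply: eq_bigr => i _; rewrite /= count_map.
Qed.

Lemma count_box d (P : pred 'I_k) :
  count (fun v => P v.1) (vertices d) = \sum_(i | P i) d i.
Proof.
rewrite count_vertices [RHS]big_mkcond; apply: eq_bigr => i _ /=.
by case: (P i); rewrite ?count_predT ?size_iota ?count_pred0.
Qed.

Lemma size_vertices d : size (vertices d) = \sum_i d i.
Proof. by rewrite -count_predT (count_box d predT). Qed.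

(** * Matching a list of vertices with a stack of free up vertices *)

Section Match.
Variables (d a : {ffun 'I_k -> nat}).
Let step := match_step d a.
(** Running on an arbitrary list makes it possible to match a segment of boxes by itself. The free
    up vertices form a stack, topped by the leftmost one. *)
Definition mrun s := foldr step ([::], [::]) s.
Arguments mrun : simpl never.

Let mrun_cons v s : mrun (v :: s) = step v (mrun s).
Proof. by []. Qed.

Let stepE v fr arcs : step v (fr, arcs) =
  if down d a v then if fr is u :: fr' then (fr', (v, u) :: arcs) else (fr, arcs)
  else (v :: fr, arcs).
Proof. by []. Qed.

Lemma mrunE : lcmatch d a = (mrun (vertices d)).2.
Proof. by []. Qed.

Lemma mrun_count s :
  size (mrun s).2 <= count (down d a) s /\
  size (mrun s).1 + size (mrun s).2 = count (predC (down d a)) s.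
Proof.
elim: s => //= v s; rewrite mrun_cons.
by case: (mrun s) => -[|u fr] arcs; rewrite stepE /=; case: (down d a v) => /=; lia.
Qed.

(** The free vertices of [s] lie above those of [st], so the arcs inside [s] are unaffected; only
    the down vertices that [s] leaves unmatched consume the stack of [st]. *)
Lemma mrun_cat s st :
  size (foldr step st s).2 =
    size (mrun s).2 + size st.2 +
    minn (size st.1) (count (down d a) s - size (mrun s).2) /\
  size (foldr step st s).1 =
    size (mrun s).1 + (size st.1 - (count (down d a) s - size (mrun s).2)).
Proof.
elim: s => [|v s [IH1 IH2]] /=; first by lia.
have [le1 _] := mrun_count s; move: IH1 IH2 le1; rewrite mrun_cons.
case: (foldr step st s) => [[|u fr] arcs];
  case: (mrun s) => -[|u' fr'] arcs'; rewrite !stepE /=;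
  case: (down d a v) => /=; lia.
Qed.

(** The free list of the long run is that of [s] alone followed by a remainder [t] of vertices
    outside [P]; an arc ending in [P] is therefore an arc of [s] alone. *)
Lemma mrun_local s st (P : pred (vertex k)) : all P s ->
    ~~ has P st.1 -> count (fun e => P e.2) st.2 = 0 ->
  count (fun e => P e.2) (foldr step st s).2 = size (mrun s).2.
Proof.
move=> sP stP st2P.
suff: [/\ count (fun e => P e.2) (foldr step st s).2 = size (mrun s).2,
    all P (mrun s).1 &
    exists2 t, (foldr step st s).1 = (mrun s).1 ++ t & ~~ has P t] by case.
elim: s sP => [|v s IH] /=; first by split=> //; exists st.1.
case/andP=> Pv /IH {IH}; rewrite mrun_cons.
case: (foldr step st s) => fr arcs; case: (mrun s) => fr' arcs' /= [c1 al [t ->]].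
rewrite !stepE.
case: fr' al => [|u' fr'] /=; last first.
  case/andP=> Pu Pfr tP; case: (down d a v) => /=.
    by rewrite Pu c1; split=> //; exists t.
  by rewrite Pv Pu; split=> //; exists t.
move=> _ tP; case: (down d a v) => /=.
  case: t tP => [|u t] /=; first by split=> //; exists [::].
  by case/norP=> /negbTE-> tP; split=> //; exists t.
by rewrite Pv; split=> //; exists t.
Qed.

(** Arcs drawn by [s] alone are also drawn over the stack of [st]. Vertices of [st] may satisfy [P]
    as well, whence only an inequality. *)
Lemma mrun_within s st (P : pred (vertex k)) : all P s ->
  size (mrun s).2 <= count (fun e => P e.1 && P e.2) (foldr step st s).2.
Proof.
move=> sP.
suff: [/\ size (mrun s).2 <= count (fun e => P e.1 && P e.2) (foldr step st s).2,
    all P (mrun s).1 & exists t, (foldr step st s).1 = (mrun s).1 ++ t] by case.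
elim: s sP => [|v s IH] /=; first by split=> //; exists st.1.
case/andP=> Pv /IH {IH}; rewrite mrun_cons.
case: (foldr step st s) => fr arcs; case: (mrun s) => fr' arcs' /= [c1 al [t ->]].
rewrite !stepE.
case: fr' al => [|u' fr'] /=; last first.
  case/andP=> Pu Pfr; case: (down d a v) => /=.
    by rewrite Pu Pv; split=> //; exists t.
  by rewrite Pv Pu; split=> //; exists t.
move=> _; case: (down d a v) => /=.
  case: t => [|u t] /=; first by split=> //; exists [::].
  by split=> //; [lia | exists t].
by rewrite Pv; split=> //; exists t.
Qed.

Lemma mrun_grow s st (Q : pred (vertex k * vertex k)) :
  count Q st.2 <= count Q (foldr step st s).2.
Proof.
elim: s => //= v s IH.
case: (foldr step st s) IH => [[|u fr] arcs] /=; rewrite stepE; case: (down d a v) => //=; lia.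
Qed.

(* Split at the leftmost unmatched down vertex, if there is one. *)
Lemma mrun_cut s : size (mrun s).2 = count (down d a) s \/
  exists p v q, s = p ++ v :: q /\
    size (mrun s).2 = count (down d a) p + count (predC (down d a)) q.
Proof.
elim: s => [|v s IH] /=; first by left.
have [_] := mrun_count s; move: IH; rewrite mrun_cons.
case: (mrun s) => fr arcs; rewrite stepE /= => IH szE; case dv: (down d a v) => /=; last first.
  case: IH => [|[p [w [q [-> E]]]]]; first by left.
  by right; exists (v :: p), w, q; rewrite /= dv E.
case: fr szE => [|u fr] szE /=.
  by right; exists [::], v, s; rewrite /= -szE.
case: IH => [->|[p [w [q [-> E]]]]]; first by left; lia.
by right; exists (v :: p), w, q; rewrite /= dv E; split=> //; lia.
Qed.

Definition vlt (v w : vertex k) :=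
  (v.1 < w.1) || ((v.1 == w.1) && (v.2 < w.2)).

Lemma vlt_vertices : pairwise vlt (vertices d).
Proof.
rewrite /vertices; have : pairwise ltn (map val (enum 'I_k)).
  by rewrite val_enum_ord -sorted_pairwise ?iota_ltn_sorted //; apply: ltn_trans.
elim: (enum 'I_k) => //= i l IH /andP[il /IH IHl].
rewrite pairwise_cat IHl andbT; apply/andP; split; last first.
  have : pairwise ltn (iota 0 (d i)).
    by rewrite -sorted_pairwise ?iota_ltn_sorted //; apply: ltn_trans.
  elim: (iota 0 (d i)) => //= j r IHr /andP[jr /IHr ->]; rewrite andbT.
  apply/allP=> w /mapP[j' j'r ->]; rewrite /vlt /= eqxx.
  by have /= -> := allP jr _ j'r; rewrite orbT.
apply/allrelP => v w /mapP[j _ ->] /allpairsPdep[i' [j' [i'l _ ->]]].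
by have /= := allP il _ (map_f val i'l); rewrite /vlt /= => ->.
Qed.

Lemma vertices_uniq : uniq (vertices d).
Proof.
apply: pairwise_uniq vlt_vertices => v; rewrite /vlt !ltnn eqxx //.
Qed.

(** Right endpoints are popped in an order different from that of the list, hence a permutation;
    left endpoints are recorded in reading order, hence the subsequence in [mrun_subseq]. *)
Lemma mrun_perm s :
  perm_eq ((mrun s).1 ++ map snd (mrun s).2) (filter (predC (down d a)) s).
Proof.
elim: s => //= v s; rewrite mrun_cons.
case: (mrun s) => fr arcs; rewrite stepE /=; case: (down d a v) => /=; last by rewrite perm_cons.
case: fr => [|u fr] //=; apply: perm_trans.
by rewrite -[map snd arcs]/(nil ++ _) -cat1s perm_catCA.
Qed.

Lemma mrun_subseq s : subseq (map fst (mrun s).2) (filter (down d a) s).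
Proof.
elim: s => //= v s; rewrite mrun_cons.
case: (mrun s) => fr arcs; rewrite stepE /=; case: (down d a v) => //=.
case: fr => [|u fr] h; last by rewrite /= eqxx.
exact: subseq_trans h (subseq_cons _ _).
Qed.

(** The down vertices of a box are its rightmost ones, so an up vertex to the right of a down vertex
    belongs to a later box. *)
Lemma mrun_lt s : pairwise vlt s ->
  forall e, e \in (mrun s).2 -> e.1.1 < e.2.1.
Proof.
elim: s => //= v s IH /andP[vs /IH {}IH] e; have P := mrun_perm s; move: IH.
rewrite mrun_cons; case: (mrun s) P => fr arcs /= P IH; rewrite stepE.
case dv: (down d a v) => /=; last exact: IH.
case: fr P => [|u fr] P; first exact: IH.
rewrite inE => /predU1P[->|/IH//] /=.
have : u \in filter (predC (down d a)) s by rewrite -(perm_mem P) inE eqxx.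
rewrite mem_filter => /andP[/= du us].
have := allP vs _ us; rewrite /vlt => /orP[//|/andP[/eqP uv]].
by move: dv du; rewrite /down uv; lia.
Qed.

Lemma lcmatch_perm :
  perm_eq ((mrun (vertices d)).1 ++ map snd (lcmatch d a))
    (filter (predC (down d a)) (vertices d)).
Proof. exact: mrun_perm. Qed.

Lemma lcmatch_uniq1 : uniq (map fst (lcmatch d a)).
Proof. exact: subseq_uniq (mrun_subseq _) (filter_uniq _ vertices_uniq). Qed.

Lemma lcmatch_uniq2 : uniq (map snd (lcmatch d a)).
Proof.
have := filter_uniq (predC (down d a)) vertices_uniq.
by rewrite -(perm_uniq lcmatch_perm) cat_uniq => /and3P[].
Qed.

Lemma lcmatch_down e : e \in lcmatch d a ->
  (e.1 \in vertices d) && down d a e.1.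
Proof.
move=> /(map_f fst) /(mem_subseq (mrun_subseq _)).
by rewrite mem_filter andbC.
Qed.

Lemma lcmatch_up e : e \in lcmatch d a ->
  (e.2 \in vertices d) && ~~ down d a e.2.
Proof.
move=> ea; have : e.2 \in filter (predC (down d a)) (vertices d).
  by rewrite -(perm_mem lcmatch_perm) mem_cat (map_f snd ea) orbT.
by rewrite mem_filter andbC.
Qed.

Lemma lcmatch_lt e : e \in lcmatch d a -> e.1.1 < e.2.1.
Proof. exact/mrun_lt/vlt_vertices. Qed.

Definition seg p q := [seq v : vertex k <- vertices d | p <= v.1 < q].

Lemma filter_vlt_cat s i : pairwise vlt s ->
  s = [seq v : vertex k <- s | v.1 < i] ++ [seq v : vertex k <- s | i <= v.1].
Proof.
elim: s => //= v s IH /andP[vs /IH {}IH]; case: ltnP => vi /=.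
  by rewrite -IH.
rewrite (eq_in_filter (a2 := pred0)) ?filter_pred0; last first.
  move=> w /(allP vs); rewrite /vlt.
  by case/orP => [|/andP[/eqP <- _]]; apply: contraTF; lia.
rewrite (eq_in_filter (a2 := predT)) ?filter_predT //.
move=> w /(allP vs); rewrite /vlt /=.
by case/orP => [|/andP[/eqP <- _] //]; lia.
Qed.

Lemma seg_cat p m q : p <= m <= q -> seg p q = seg p m ++ seg m q.
Proof.
move=> pmq; have := pairwise_filter (fun v : vertex k => p <= v.1 < q) vlt_vertices.
rewrite -/(seg p q) => /(filter_vlt_cat m) ->; rewrite -!filter_predI.
by congr (_ ++ _); apply: eq_filter => v /=; lia.
Qed.

Lemma seg_vertices : vertices d = seg 0 k.
Proof.
by rewrite /seg (eq_filter (a2 := predT)) ?filter_predT // => v /=; rewrite ltn_ord.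
Qed.

Lemma count_seg p q (P : pred (vertex k)) : count P (seg p q) =
  count (fun v : vertex k => (p <= v.1 < q) && P v) (vertices d).
Proof. by rewrite count_filter; apply: eq_count => v /=; rewrite andbC. Qed.

(** The complement of [match_n] in [d]; it is this composition that obeys a recursion over the
    boxes. *)
Definition match_u : {ffun 'I_k -> nat} :=
  [ffun i => count (fun e : vertex k * vertex k => e.2.1 == i) (lcmatch d a)].

Lemma match_nE i : match_n d a i = d i - match_u i.
Proof. by rewrite !ffunE. Qed.

Lemma sum_count_box (T : Type) (g : T -> 'I_k) (s : seq T) (P : pred 'I_k) :
  \sum_(i | P i) count (fun e => g e == i) s = count (fun e => P (g e)) s.
Proof.
elim: s => [|e s IH] /=; first by rewrite big1.
rewrite big_split /= IH; congr (_ + _).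
case Pe: (P (g e)); last first.
  by rewrite big1 // => i Pi; case: eqP => // E; rewrite -E Pe in Pi.
rewrite (bigD1 (g e)) //= eqxx big1 ?addn0 // => i /andP[_].
by rewrite eq_sym => /negbTE->.
Qed.

Lemma psum_match_u i : psum match_u i =
  count (fun e : vertex k * vertex k => e.2.1 < i) (lcmatch d a).
Proof.
rewrite /psum (eq_bigr (fun l => count
  (fun e : vertex k * vertex k => e.2.1 == l) (lcmatch d a))) => [|l _]; last first.
  by rewrite ffunE.
exact: (sum_count_box (fun e : vertex k * vertex k => e.2.1) _ (fun l => l < i)).
Qed.

(** An arc that ends before box [i] lies before box [i] entirely, so the later boxes may be
    dropped. *)
Lemma psum_match_u_seg i : i <= k -> psum match_u i = size (mrun (seg 0 i)).2.
Proof.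
move=> ik; rewrite psum_match_u mrunE seg_vertices (@seg_cat 0 i k) //.
rewrite /mrun foldr_cat -/(mrun _) -/(mrun _).
have allge : all (fun v : vertex k => i <= v.1) (seg i k).
  by apply/allP => v; rewrite mem_filter => /andP[/andP[]].
have P := mrun_perm (seg i k).
have mem_ge v : v \in (mrun (seg i k)).1 ++ map snd (mrun (seg i k)).2 -> i <= v.1.
  by rewrite (perm_mem P) mem_filter => /andP[_ /(allP allge)].
have N1 : ~~ has (fun v : vertex k => v.1 < i) (mrun (seg i k)).1.
  by apply/hasPn => v vm; rewrite -leqNgt mem_ge // mem_cat vm.
have N2 : count (fun e : vertex k * vertex k => e.2.1 < i) (mrun (seg i k)).2 = 0.
  apply/eqP; rewrite -leqn0 leqNgt -has_count; apply/hasPn => e em.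
  by rewrite -leqNgt mem_ge // mem_cat (map_f snd em) orbT.
apply: (@mrun_local (seg 0 i) (mrun (seg i k)) (fun v : vertex k => v.1 < i)) => //.
by apply/allP => v; rewrite mem_filter => /andP[].
Qed.

Hypothesis had : forall i, a i <= d i.

Lemma count_down (P : pred 'I_k) :
  count (fun v => P v.1 && down d a v) (vertices d) = \sum_(i | P i) a i.
Proof.
rewrite count_vertices [RHS]big_mkcond; apply: eq_bigr => i _ /=.
case: (P i) => /=; last exact: count_pred0.
rewrite /down /=; have := had i; move: (d i) (a i) => m b bm.
rewrite -{2}(subnK bm) iotaD count_cat add0n.
rewrite (eq_in_count (a2 := pred0)) ?count_pred0; last first.
  by move=> j; rewrite mem_iota /=; lia.
rewrite (eq_in_count (a2 := predT)) ?count_predT ?size_iota //.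
by move=> j; rewrite mem_iota /=; lia.
Qed.

Lemma count_down_seg p q : p <= q ->
  count (down d a) (seg p q) = psum a q - psum a p.
Proof.
by move=> pq; rewrite count_seg (count_down (fun i => p <= i < q)) sum_range.
Qed.

Lemma size_seg p q : p <= q -> size (seg p q) = psum d q - psum d p.
Proof.
move=> pq; rewrite size_filter (count_box d (fun i => p <= i < q)).
exact: sum_range.
Qed.

Lemma count_up_seg p q : p <= q ->
  count (predC (down d a)) (seg p q) = psum d q - psum d p - (psum a q - psum a p).
Proof.
move=> pq; rewrite -(size_seg pq) -(count_down_seg pq).
by rewrite -(count_predC (down d a)) addKn.
Qed.

(** At a standard point this is the rank of [t] from [D_q] to [D / D_p]; see
    [dense_point_of_basis]. *)
Definition arcs_in p q :=
  count (fun e : vertex k * vertex k => (p <= e.1.1) && (e.2.1 < q)) (lcmatch d a).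

(** Cut the segment at its leftmost unmatched down vertex, in box [l]: the down vertices before it
    are matched, and so are the up vertices after it. So there are at least as many arcs as down
    vertices before box [l] plus up vertices after it. *)
Lemma arcs_in_ge p q : p < q -> q <= k ->
  exists2 l, p <= l < q &
    psum a l + psum a l.+1 + psum d q <=
      arcs_in p q + psum a p + psum d l.+1 + psum a q.
Proof.
move=> pq qk; have S : size (mrun (seg p q)).2 <= arcs_in p q.
  rewrite /arcs_in mrunE seg_vertices (@seg_cat 0 p k) ?(@seg_cat p q k); try lia.
  rewrite /mrun !foldr_cat; apply: leq_trans (mrun_grow _ _ _).
  set st := foldr step _ (seg q k).
  apply: leq_trans (@mrun_within (seg p q) st (fun v : vertex k => p <= v.1 < q) _) _.
    by apply/allP => v; rewrite mem_filter => /andP[].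
  by apply: sub_count => e /=; lia.
have mono := psum_mono a; have leD := leq_psum had; have monod := psum_mono d.
have := mrun_cut (seg p q); case.
  (* Every down vertex is matched, and no up vertex of the segment lies beyond its last box. *)
  rewrite count_down_seg ?(ltnW pq) // => E; exists q.-1; first by lia.
  rewrite prednK ?(leq_ltn_trans _ pq) //.
  have := mono _ _ (ltnW pq); have := mono _ _ (leq_pred q); lia.
move=> [s1 [v [s2 [E szE]]]].
have vpq : p <= v.1 < q.
  have : v \in seg p q by rewrite E mem_cat inE eqxx orbT.
  by rewrite mem_filter => /andP[].
exists v.1 => //.
have PW : pairwise vlt (s1 ++ v :: s2).
  by rewrite -E; apply: pairwise_filter; apply: vlt_vertices.
move: PW; rewrite pairwise_cat => /and3P[/allrelP r12 _ /= /andP[/allP vs2 _]].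
(* By the reading order, [s1] contains all boxes of the segment before that of [v], and [s2] all
   those after it. *)
have D1 : psum a v.1 - psum a p <= count (down d a) s1.
  have pv : p <= v.1 by lia.
  have qv : v.1 <= q by lia.
  rewrite -(count_down_seg pv).
  have -> : seg p v.1 = [seq w : vertex k <- seg p q | w.1 < v.1].
    by rewrite -filter_predI; apply: eq_filter => w /=; lia.
  rewrite E filter_cat /= ltnn [X in _ ++ X](_ : _ = [::]) ?cats0.
    by rewrite count_filter; apply: sub_count => w /andP[].
  apply/eqP; rewrite -[_ == _]negbK -has_filter; apply/hasPn => w /vs2.
  by rewrite /vlt => /orP[|/andP[/eqP-> _]]; lia.
have D2 : psum d q - psum d v.1.+1 - (psum a q - psum a v.1.+1)
    <= count (predC (down d a)) s2.
  have qv : v.1.+1 <= q by lia.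
  rewrite -(count_up_seg qv).
  have -> : seg v.1.+1 q = [seq w : vertex k <- seg p q | v.1 < w.1].
    by rewrite -filter_predI; apply: eq_filter => w /=; lia.
  rewrite E filter_cat /= ltnn [X in X ++ _](_ : _ = [::]) /=.
    by rewrite count_filter; apply: sub_count => w /andP[].
  apply/eqP; rewrite -[_ == _]negbK -has_filter; apply/hasPn => w ws1.
  have := r12 w v ws1; rewrite inE eqxx => /(_ isT).
  by rewrite /vlt => /orP[|/andP[/eqP-> _]]; lia.
have vq : v.1.+1 <= q by lia.
have := leD _ _ vq; have := mono _ _ vq; have := monod _ _ vq.
by have := mono p v.1; lia.
Qed.

(* Reading the boxes from left to right, a right endpoint closes an open down
   vertex; [psum a i - psum match_u i] of them are open before box [i]. *)
Lemma match_u_rec (i : 'I_k) :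
  match_u i = minn (d i - a i) (psum a i - psum match_u i).
Proof.
have ik := ltn_ord i.
have E := psumS match_u i; rewrite !psum_match_u_seg ?(ltnW ik) // in E.
rewrite psum_match_u_seg ?(ltnW ik) //.
have C : seg 0 i.+1 = seg 0 i ++ seg i i.+1 by apply: seg_cat; lia.
rewrite C {1}/mrun foldr_cat -/(mrun _) in E.
have [E2 _] := mrun_cat (seg 0 i) (mrun (seg i i.+1)); rewrite E2 in E.
(* No arc joins two vertices of the same box. *)
have Z : (mrun (seg i i.+1)).2 = [::].
  case eqA: (mrun _).2 => [//|e l].
  have eA : e \in (mrun (seg i i.+1)).2 by rewrite eqA inE eqxx.
  have lt := mrun_lt (pairwise_filter _ vlt_vertices) eA.
  have := map_f fst eA => /(mem_subseq (mrun_subseq _)).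
  rewrite !mem_filter => /and3P[_ e1 _].
  have : e.2 \in (mrun (seg i i.+1)).1 ++ map snd (mrun (seg i i.+1)).2.
    by rewrite mem_cat (map_f snd eA) orbT.
  rewrite (perm_mem (mrun_perm _)) !mem_filter => /and3P[_ /andP[_ e2] _].
  by case/andP: e1 => e1 _; rewrite ltnS leqNgt (leq_ltn_trans e1 lt) in e2.
have [_ S] := mrun_count (seg i i.+1).
rewrite count_up_seg // Z addn0 !psumS !addKn in S.
by move: E; rewrite Z S count_down_seg // psum0 subn0 /=; lia.
Qed.

End Match.

(** The recursion at box [i] involves only earlier entries of [u], through [psum u i], so it
    determines [u]. *)
Lemma match_u_eq d a u : (forall i, a i <= d i) ->
  (forall i, u i = minn (d i - a i) (psum a i - psum u i)) -> match_u d a = u.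
Proof.
move=> had hu; apply: eq_psum; elim=> [|i IH] ik; first by rewrite !psum0.
rewrite -[i]/(val (Ordinal ik)) !psumS match_u_rec // hu /= IH //.
exact: ltnW.
Qed.

(* [a'] turns the leftmost unmatched down vertex up, which does not affect the
   arcs. *)
Lemma flip_unmatched d a u : (forall i, a i <= d i) ->
    (forall i, u i = minn (d i - a i) (psum a i - psum u i)) ->
    psum u k < psum a k ->
  exists a' : {ffun 'I_k -> nat},
    [/\ forall i, a' i <= d i,
        forall i, u i = minn (d i - a' i) (psum a' i - psum u i) &
        (psum a' k).+1 = psum a k].
Proof.
move=> had hu lt.
have leU i : i <= k -> psum u i <= psum a i.
  elim: i => [|i IH] ik; first by rewrite !psum0.
  have := hu (Ordinal ik); have := IH (ltnW ik).
  by rewrite -[i]/(val (Ordinal ik)) !psumS /=; lia.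
have leU1 (i : 'I_k) : psum u i.+1 <= psum a i.
  by rewrite psumS; have := hu i; have := leU i (ltnW (ltn_ord i)); lia.
have k0 : 0 < k by case: (k) lt leU => // lt leU; rewrite !psum0 in lt.
(* [P i] says that no down vertex before box [i] is still open once the up vertices of box [i] are
   used. After the last such box some vertex is always open, so the leftmost down vertex of that box
   is never matched. *)
pose P i := psum a i == psum u i.+1.
have P0 : [exists i : 'I_k, P i].
  apply/existsP; exists (Ordinal k0); rewrite /P /= psum0 eq_sym.
  by have := leU1 (Ordinal k0); rewrite psum0 leqn0.
case/existsP: P0 => i0 Pi0.
case: (@arg_maxnP _ i0 (fun i : 'I_k => P i) val Pi0) => i /eqP Pi imax.
have ai : 0 < a i.
  suff : psum u i.+1 < psum a i.+1 by rewrite -Pi psumS; lia.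
  have [ik|ki] := ltnP i.+1 k; last first.
    by have -> : i.+1 = k by have := ltn_ord i; lia.
  have le := leU1 (Ordinal ik); rewrite /= in le.
  have ne : psum a i.+1 != psum u i.+2.
    by apply/negP => /(imax (Ordinal ik)); rewrite /= ltnn.
  have := psum_mono u (leqnSn i.+1); lia.
pose a' := [ffun l => a l - (l == i)]; exists a'.
have psumE l : psum a' l = psum a l - (i < l).
  suff -> : psum a l = psum a' l + (i < l) by rewrite addnK.
  rewrite /psum (eq_bigr (fun j => a' j + (j == i))) => [|j _]; last first.
    by rewrite ffunE; case: eqP => [->|_]; rewrite ?subn0 ?addn0 // subnK.
  rewrite big_split /=; congr (_ + _); case: ltnP => il.
    by rewrite (bigD1 i) //= eqxx big1 // => j /andP[_ /negbTE->].
  by rewrite big1 // => j jl; case: eqP => // ji; rewrite ji ltnNge il in jl.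
have psum_pos l : i < l -> 0 < psum a l.
  by move=> il; have := psum_mono a il; rewrite psumS; lia.
split=> [l|l|]; first by rewrite ffunE; have := had l; lia.
(* At box [i] the minimum is the number of open vertices; beyond it, the number of up vertices, with
   strict inequality. One more up vertex at [i] and one open vertex fewer afterwards thus change no
   minimum. *)
- have hl := hu l; rewrite psumE ffunE; case: eqP => [->|/eqP li].
    rewrite ltnn subn0; move: Pi (hu i); rewrite psumS.
    have := had i; have := leU i (ltnW (ltn_ord i)); lia.
  rewrite subn0; case: ltnP => il; last by rewrite subn0.
  have ne : psum a l != psum u l.+1.
    by apply/negP => /(imax l); rewrite /= leqNgt il.
  by have := leU1 l; rewrite psumS in ne *; have := had l; lia.
- by rewrite psumE ltn_ord; have := psum_pos k (ltn_ord i); lia.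
Qed.

(** Start with [a = n], where the second hypothesis makes every up vertex matched, and flip
    unmatched down vertices one at a time until [m] down vertices are left; the bound on [m] from
    below ensures that an unmatched one exists. *)
Lemma match_n_surj d n m : (forall i, n i <= d i) ->
    (forall i : 'I_k, psum d i.+1 <= psum n i.+1 + psum n i) ->
    psum d k <= psum n k + m -> m <= psum n k ->
  exists a : {ffun 'I_k -> nat},
    [/\ forall i, a i <= d i, match_n d a = n & \sum_i a i = m].
Proof.
move=> hnd hn m1 m2; pose u := [ffun i => d i - n i].
have pu i : i <= k -> psum u i + psum n i = psum d i.
  elim: i => [|i IH] ik; first by rewrite !psum0.
  rewrite -[i]/(val (Ordinal ik)) !psumS ffunE.
  by have := IH (ltnW ik); have := hnd (Ordinal ik); rewrite /=; lia.
suff [a [a1 a2 a3]] : exists a : {ffun 'I_k -> nat}, [/\ forall i, a i <= d i,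
     forall i, u i = minn (d i - a i) (psum a i - psum u i) & psum a k = m].
  exists a; split=> //; last by rewrite -a3 psum_full.
  apply/ffunP => i; rewrite match_nE (match_u_eq a1 a2) ffunE.
  exact: subKn (hnd i).
have {m1} : psum u k <= m by have := pu k (leqnn k); lia.
move: {2}(psum n k - m) (erefl (psum n k - m)) => c.
elim: c m m2 => [|c IH] m m2 cE mu.
  exists n; split=> // [i|]; last by lia.
  have := hn i; have := pu _ (ltn_ord i); have := pu _ (ltnW (ltn_ord i)).
  by rewrite !psumS ffunE; have := hnd i; lia.
have [|||a [a1 a2 a3]] := IH m.+1; [lia|lia|lia|].
have [|a' [b1 b2 b3]] := flip_unmatched a1 a2; first by rewrite a3.
by exists a'; split=> //; lia.
Qed.

(* On a maximal interval where the partial sums of [b] stay below those of [a],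
   every cut for [b] is smaller than the same cut for [a]. *)
Lemma rank_dominance d a b : (forall i, a i <= d i) ->
    (forall i, i <= k -> psum b i <= psum a i) -> psum b k = psum a k ->
    (forall p l q, p <= l < q -> q <= k ->
       arcs_in d a p q + psum b p + psum d l.+1 + psum b q <=
         psum b l + psum b l.+1 + psum d q) ->
  a = b.
Proof.
move=> had ba bak cut; apply: eq_psum => i ik; apply/eqP; apply: contraT => ne.
pose P j := psum a j == psum b j.
have exp : exists j, P j && (j <= i) by exists 0; rewrite /P !psum0 eqxx.
have bnd j : P j && (j <= i) -> j <= i by case/andP.
case: (ex_maxnP exp bnd) => p /andP[/eqP Pp pi] pmax.
have exq : exists j, P j && (i <= j) by exists k; rewrite /P bak eqxx.
case: (ex_minnP exq) => q /andP[/eqP Pq iq] qmin.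
have qk : q <= k by apply: qmin; rewrite /P bak eqxx.
have pne : p != i by apply: contraNneq ne => <-; rewrite Pp.
have qne : q != i by apply: contraNneq ne => <-; rewrite Pq.
have lt j : p < j < q -> psum b j < psum a j.
  move=> /andP[pj jq]; rewrite ltn_neqAle ba ?andbT; last by lia.
  apply/negP => /eqP E; have [ji|ij] := leqP j i.
    by have := pmax j; rewrite /P E eqxx ji => /(_ isT); lia.
  by have := qmin j; rewrite /P E eqxx (ltnW ij) => /(_ isT); lia.
have pq : p < q by lia.
have [l plq ge] := arcs_in_ge had pq qk.
have := cut p l q plq qk.
(* As [i] lies strictly between [p] and [q], at least one of [l] and [l.+1] does too. *)
have ltS : psum b l + psum b l.+1 < psum a l + psum a l.+1.
  have [lp|lp] := eqVneq l p.
    by have := lt l.+1; have := ba l; lia.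
  by have := lt l; have := ba l.+1; lia.
lia.
Qed.

End Combinatorics.

(** * Flags and adapted bases *)

Section Flags.
Local Open Scope nat_scope.
Variables (E : fieldType) (V : vectType E) (k : nat) (d : {ffun 'I_k -> nat}).
Implicit Types (D : filtration V k) (x : tpv V d) (X : {vspace V}).

(** Indexing by [nat] removes the casts in [below] and [upto]; for [i > k] the value is the term of
    index 0. *)
Definition fl D (i : nat) : {vspace V} := D (inord i).

Lemma belowE D i : below D i = fl D i.
Proof.
by congr (D _); apply: val_inj; rewrite /= inordK // ltnS ltnW.
Qed.

Lemma uptoE D i : upto D i = fl D i.+1.
Proof. by congr (D _); apply: val_inj; rewrite /= inordK // ltnS. Qed.

Lemma flE D (i : 'I_k.+1) : D i = fl D i.
Proof. by rewrite /fl inord_val. Qed.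

Lemma eq_fl D D' : (forall i, i <= k -> fl D i = fl D' i) -> D = D'.
Proof. by move=> DD; apply/ffunP => i; rewrite !flE DD // -ltnS. Qed.

Lemma is_flagP D : reflect
  [/\ fl D 0 = 0%VS, fl D k = fullv,
      forall i, i < k -> (fl D i <= fl D i.+1)%VS &
      forall i, i <= k -> \dim (fl D i) = psum d i]
  (is_flag d D).
Proof.
have E0 : D ord0 = fl D 0 by rewrite flE.
have Ek : D ord_max = fl D k by rewrite flE.
rewrite /is_flag E0 Ek; apply: (iffP and4P) => [[/eqP D0 /eqP Dk /forallP DS dimD]|].
  split=> // [i ik|]; first by have := DS (Ordinal ik); rewrite belowE uptoE.
  elim=> [|i IH] ik; first by rewrite D0 dimv0 psum0.
  move/forallP: dimD => /(_ (Ordinal ik)); rewrite belowE uptoE /= IH ?(ltnW ik) //.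
  by move/eqP->; rewrite -(psumS d (Ordinal ik)).
case=> -> -> DS dimD; split=> //; apply/forallP => i; rewrite belowE uptoE.
  exact: DS.
by rewrite !dimD ?(ltnW (ltn_ord i)) // psumS.
Qed.

Lemma fl0 x : fl (flag x) 0 = 0%VS.
Proof. by case/is_flagP: (flagP x). Qed.

Lemma flk x : fl (flag x) k = fullv.
Proof. by case/is_flagP: (flagP x). Qed.

Lemma fl_dim x i : i <= k -> \dim (fl (flag x) i) = psum d i.
Proof. by case/is_flagP: (flagP x) => _ _ _ h /h. Qed.

Lemma fl_mono x i j : i <= j -> j <= k -> (fl (flag x) i <= fl (flag x) j)%VS.
Proof.
case/is_flagP: (flagP x) => _ _ DS _ ij.
rewrite -(subnK ij); elim: (j - i) => [|m IH] mk //.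
by apply: subv_trans (IH (ltnW mk)) (DS _ _).
Qed.

Lemma endo_fl x i : i < k -> (endo x @: fl (flag x) i.+1 <= fl (flag x) i)%VS.
Proof.
by move=> ik; have /forallP/(_ (Ordinal ik)) := endo_flag x; rewrite belowE uptoE.
Qed.

Lemma limg_mid x : (limg (endo x) <= mid x)%VS.
Proof. by case/andP: (mid_endo x). Qed.

Lemma mid_lker x : (mid x <= lker (endo x))%VS.
Proof. by case/andP: (mid_endo x). Qed.

Lemma psum_alpha X x i : i <= k ->
  psum (alpha X (flag x)) i = \dim (X :&: fl (flag x) i).
Proof.
elim: i => [|i IH] ik; first by rewrite psum0 fl0 capv0 dimv0.
rewrite -[i]/(val (Ordinal ik)) psumS /= IH ?(ltnW ik) // ffunE belowE uptoE /=.
by rewrite subnKC // dimvS // capvS // fl_mono.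
Qed.

Lemma alpha_eq X x f : (forall i, i <= k -> \dim (X :&: fl (flag x) i) = psum f i) ->
  alpha X (flag x) = f.
Proof. by move=> H; apply: eq_psum => i ik; rewrite psum_alpha ?H. Qed.

Lemma sum_alpha X x : \sum_i alpha X (flag x) i = \dim X.
Proof. by rewrite -(psum_full _ (leqnn k)) psum_alpha // flk capvf. Qed.

(** The quotient of [X :&: D_(i+1)] by [X :&: D_i] embeds in [D_(i+1) / D_i]. *)
Lemma alpha_le X x i : alpha X (flag x) i <= d i.
Proof.
have ik := ltn_ord i; have := psum_alpha X x ik; have := psum_alpha X x (ltnW ik).
have := psumS d i; rewrite -(fl_dim x ik) -(fl_dim x (ltnW ik)) psumS.
have := dimv_sum_cap (X :&: fl (flag x) i.+1) (fl (flag x) i).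
have /dimvS : (X :&: fl (flag x) i.+1 + fl (flag x) i <= fl (flag x) i.+1)%VS.
  by rewrite subv_add capvSr fl_mono.
rewrite -capvA [(fl _ i.+1 :&: _)%VS]capvC.
have /capv_idPl -> := fl_mono x (leqnSn i) ik; lia.
Qed.

(** Let [U = D_(l+1) + W :&: D_q]. Since [t] kills [W] and maps [D_(l+1)] into [W :&: D_l], the rank
    of [D_q -> D / D_p] is at most the dimension of [W :&: D_l] modulo [W :&: D_p] plus the
    codimension of [U] in [D_q]. This is the linear counterpart of the count in [arcs_in_ge]. *)
Lemma rank_cut x b p l q : alpha (mid x) (flag x) = b ->
    p <= l < q -> q <= k ->
  \dim (endo x @: fl (flag x) q + fl (flag x) p) + psum b p + psum d l.+1 + psum b q
    <= psum d p + psum b l + psum b l.+1 + psum d q.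
Proof.
move=> bdef plq qk; set D := fl (flag x); set t := endo x; set W := mid x.
have bE i : i <= k -> psum b i = \dim (W :&: D i) by move=> ik; rewrite -bdef psum_alpha.
have DE i : i <= k -> \dim (D i) = psum d i by exact: fl_dim.
pose U := (D l.+1 + W :&: D q)%VS.
have Uq : (U <= D q)%VS by rewrite subv_add capvSr fl_mono //; lia.
have tU : (t @: U <= W :&: D l)%VS.
  rewrite limgD subv_add; apply/andP; split.
    rewrite subv_cap endo_fl ?andbT; last by lia.
    exact: subv_trans (limgS _ (subvf _)) (limg_mid x).
  suff -> : (t @: (W :&: D q) = 0)%VS by apply: sub0v.
  by apply/eqP; rewrite -lkerE; apply: subv_trans (capvSl _ _) (mid_lker x).
have tD : (t @: D q + D p <= (W :&: D l + D p) + t @: (D q :\: U))%VS.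
  have -> : (t @: D q = t @: (D q :\: U) + t @: U)%VS.
    by rewrite -{1}(addv_diff_cap (D q) U) (capv_idPr Uq) limgD.
  rewrite !subv_add addvSr /=; apply/andP; split.
    exact: subv_trans tU (subv_trans (addvSl _ _) (addvSl _ _)).
  exact: subv_trans (addvSr _ _) (addvSl _ _).
have dimU : \dim U + psum b l.+1 = psum d l.+1 + psum b q.
  rewrite -DE ?bE; try lia.
  rewrite -[RHS]dimv_sum_cap; congr (_ + \dim _).
  rewrite [RHS]capvC -capvA; congr (_ :&: _)%VS.
  by apply/esym/capv_idPr; apply: fl_mono; lia.
have dimC := dimv_cap_compl (D q) U; rewrite (capv_idPr Uq) DE // in dimC.
have := limg_ker_dim t (D q :\: U).
have := dimv_sum_cap (W :&: D l) (D p).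
rewrite -capvA [(D l :&: _)%VS]capvC.
have -> : (D p :&: D l = D p)%VS by apply/capv_idPl/fl_mono; lia.
rewrite -!bE ?DE; try lia.
have := dimvS tD; have := dimv_sum_cap (W :&: D l + D p) (t @: (D q :\: U)).
lia.
Qed.

End Flags.

(** * Coordinate subspaces, standard points and adapted bases *)

Section Adapted.
Local Open Scope nat_scope.
Variables (E : fieldType) (V : vectType E) (k : nat) (d : {ffun 'I_k -> nat}).
Implicit Types (e : vertex k -> V) (P Q : pred (vertex k)).

(** For a basis [e], sums, intersections and dimensions of such subspaces become unions,
    intersections and counts of predicates. *)
Definition spanV e P : {vspace V} := <<[seq e v | v <- vertices d & P v]>>%VS.

Lemma eq_spanV e P Q : {in vertices d, P =1 Q} -> spanV e P = spanV e Q.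
Proof. by move=> PQ; rewrite /spanV (eq_in_filter PQ). Qed.

Lemma spanVU e P Q : spanV e (predU P Q) = (spanV e P + spanV e Q)%VS.
Proof.
rewrite /spanV -span_cat -map_cat; apply/eq_span/eq_mem_map => w.
by rewrite mem_cat !mem_filter -andb_orl.
Qed.

Lemma spanV_sub e P (X : {vspace V}) : (forall v, v \in vertices d -> P v -> e v \in X) ->
  (spanV e P <= X)%VS.
Proof.
move=> H; apply/span_subvP => u /mapP[v]; rewrite mem_filter => /andP[Pv vd] ->.
exact: H.
Qed.

Lemma mem_spanV e P v : v \in vertices d -> P v -> e v \in spanV e P.
Proof. by move=> vd Pv; apply/memv_span/map_f; rewrite mem_filter Pv. Qed.

Definition vflag e : filtration V k :=
  [ffun i => spanV e (fun v => v.1 < (i : 'I_k.+1))].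

Lemma fl_vflag e i : i <= k -> fl (vflag e) i = spanV e (fun v : vertex k => v.1 < i).
Proof. by move=> ik; rewrite /fl ffunE inordK. Qed.

Lemma vflag_take e i : i <= k ->
  fl (vflag e) i = <<take (psum d i) [seq e v | v <- vertices d]>>%VS.
Proof.
move=> ik; rewrite fl_vflag // -map_take /spanV; congr (<<map e _>>%VS).
rewrite [in RHS](filter_vlt_cat i (vlt_vertices d)) take_size_cat //.
by rewrite size_filter (count_box d (fun l : 'I_k => l < i)).
Qed.

Section Basis.
Variable e : vertex k -> V.
Hypothesis eB : basis_of fullv [seq e v | v <- vertices d].

Lemma spanV_dim P : \dim (spanV e P) = count P (vertices d).
Proof.
rewrite /spanV -(size_filter P) -(size_map e); apply/eqP.
rewrite -/(free _); have := basis_free eB.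
rewrite (perm_free (Y := [seq e v | v <- vertices d & P v] ++
  [seq e v | v <- vertices d & predC P v])); first exact: catl_free.
by rewrite -map_cat perm_map // perm_sym perm_filterC.
Qed.

Lemma spanV_cap_dim P Q :
  \dim (spanV e P :&: spanV e Q) = count (predI P Q) (vertices d).
Proof.
have := dimv_sum_cap (spanV e P) (spanV e Q).
rewrite -spanVU !spanV_dim; have := count_predUI P Q (vertices d); lia.
Qed.

Lemma spanV_full : spanV e predT = fullv.
Proof. by rewrite /spanV filter_predT (span_basis eB). Qed.

Lemma vflag_is_flag : is_flag d (vflag e).
Proof.
apply/is_flagP; split=> [||i ik|i ik]; rewrite ?fl_vflag ?(ltnW ik) //.
- by rewrite /spanV filter_pred0 span_nil.
- by rewrite -spanV_full; apply: eq_spanV => v _; rewrite ltn_ord.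
- apply: spanV_sub => v vd vi; apply: mem_spanV => //; exact: ltnW.
- by rewrite spanV_dim (count_box d (fun l : 'I_k => l < i)).
Qed.

Variable a : {ffun 'I_k -> nat}.

Definition closing : pred (vertex k) := mem (map snd (lcmatch d a)).
Definition opening : pred (vertex k) := mem (map fst (lcmatch d a)).

Lemma count_arcs (Q : pred (vertex k)) (s : seq (vertex k * vertex k))
    (g : vertex k * vertex k -> vertex k) :
    {subset map g s <= vertices d} -> uniq (map g s) ->
  count (fun v => (v \in map g s) && Q v) (vertices d) =
    count (fun ar => Q (g ar)) s.
Proof.
move=> sub un; rewrite -[RHS](count_map g Q) -!size_filter; apply: perm_size.
apply: uniq_perm; rewrite ?filter_uniq ?vertices_uniq // => v.
rewrite !mem_filter; case vs: (v \in map g s); rewrite ?andbF //= andbT.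
by rewrite sub ?andbT // vs.
Qed.

Lemma count_closing Q :
  count (predI closing Q) (vertices d) = count (fun ar => Q ar.2) (lcmatch d a).
Proof.
apply: (count_arcs _ (g := snd)); last exact: lcmatch_uniq2.
by move=> v /mapP[ar /lcmatch_up/andP[? _] ->].
Qed.

Lemma count_opening (P : pred (vertex k * vertex k)) Q :
  count (fun v => (v \in map fst [seq ar <- lcmatch d a | P ar]) && Q v) (vertices d)
    = count (fun ar => P ar && Q ar.1) (lcmatch d a).
Proof.
rewrite (count_arcs _ (g := fst)).
- by rewrite count_filter; apply: eq_count => ar /=; rewrite andbC.
- move=> v /mapP[ar]; rewrite mem_filter => /andP[_ /lcmatch_down/andP[? _]] -> //.
- apply: subseq_uniq (lcmatch_uniq1 d a); apply: map_subseq; exact: filter_subseq.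
Qed.

Lemma arc_map_exists : exists t : 'End(V),
  (forall ar, ar \in lcmatch d a -> t (e ar.2) = e ar.1) /\
  (forall v, v \in vertices d -> ~~ closing v -> t (e v) = 0%R).
Proof.
(* The arc ending at [v] is found by its position in the list of right endpoints; the default [v] of
   [nth] is never reached. *)
pose r v := if closing v
  then e (nth v (map fst (lcmatch d a)) (index v (map snd (lcmatch d a)))) else 0%R.
have [f /(_ (basis_free eB))] :=
  linear_of_free [seq e v | v <- vertices d] (map r (vertices d)).
rewrite !size_map => /(_ erefl) fE.
have {fE} fE v : v \in vertices d -> f (e v) = r v.
  by move: fE; rewrite -map_comp => /eq_in_map H /H.
exists (linfun f); split=> [ar arP|v vd /negbTE nv]; rewrite lfunE /= fE //.
- have idx : index ar.2 (map snd (lcmatch d a)) = index ar (lcmatch d a).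
    rewrite -{1}(nth_index ar arP) -(nth_map ar ar.2 snd) ?index_mem //.
    by rewrite index_uniq ?size_map ?index_mem ?lcmatch_uniq2.
  by rewrite /r /closing /= (map_f snd arP) idx (nth_map ar) ?index_mem // nth_index.
- by case/andP: (lcmatch_up arP).
- by rewrite /r nv.
Qed.

Lemma limg_arcs (t : 'End(V)) P :
    (forall ar, ar \in lcmatch d a -> t (e ar.2) = e ar.1) ->
    (forall v, v \in vertices d -> ~~ closing v -> t (e v) = 0%R) ->
  (t @: spanV e P)%VS =
    spanV e (mem (map fst [seq ar <- lcmatch d a | P ar.2])).
Proof.
move=> tA tC; rewrite {1}/spanV limg_span; apply/eqP; rewrite eqEsubv; apply/andP; split.
  apply/span_subvP => u /mapP[_ /mapP[v + ->] ->].
  rewrite mem_filter => /andP[Pv vd]; case cv: (closing v); last first.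
    by rewrite tC ?cv ?mem0v.
  have /mapP[ar arP vE] : v \in map snd (lcmatch d a) by [].
  rewrite vE tA //; apply: mem_spanV; first by case/andP: (lcmatch_down arP).
  by apply: map_f; rewrite mem_filter arP -vE Pv.
apply: spanV_sub => v vd /mapP[ar]; rewrite mem_filter => /andP[Par arP] ->.
rewrite -tA //; apply/memv_span/map_f/map_f; rewrite mem_filter Par.
by case/andP: (lcmatch_up arP).
Qed.

(** One inclusion is clear; the dimensions agree because the left endpoints, which span the image,
    are as many as the right endpoints. *)
Lemma lker_arcs (t : 'End(V)) :
    (forall ar, ar \in lcmatch d a -> t (e ar.2) = e ar.1) ->
    (forall v, v \in vertices d -> ~~ closing v -> t (e v) = 0%R) ->
  lker t = spanV e (predC closing).
Proof.
move=> tA tC; apply/esym/eqP; rewrite eqEdim; apply/andP; split.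
  by apply: spanV_sub => v vd /= cv; rewrite memv_ker tC.
have := limg_ker_dim t fullv; rewrite capfv spanV_dim -{1}spanV_full limg_arcs //.
rewrite filter_predT spanV_dim -spanV_full spanV_dim count_predT.
have := count_predC closing (vertices d).
have C1 : count closing (vertices d) = size (lcmatch d a).
  rewrite -[RHS]count_predT -(count_closing predT).
  by apply: eq_count => v /=; rewrite andbT.
have C2 : count (mem (map fst (lcmatch d a))) (vertices d) = size (lcmatch d a).
  rewrite -[RHS](count_predT) -(count_opening predT predT) filter_predT.
  by apply: eq_count => v /=; rewrite andbT.
rewrite C1 C2; lia.
Qed.

Hypothesis had : forall i, a i <= d i.

(** The standard point: [t] carries right endpoints to left endpoints and [W] is spanned by the down
    vertices, which include the left endpoints and exclude the right ones. *)
Lemma dense_point_of_basis : exists x : tpv V d,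
  [/\ flag x = vflag e, lker (endo x) = spanV e (predC closing), dense_point a x &
      forall p q, p <= k -> q <= k ->
        \dim (endo x @: fl (flag x) q + fl (flag x) p) = psum d p + arcs_in d a p q].
Proof.
have [t [tA tC]] := arc_map_exists.
have limgE := limg_arcs _ tA tC; have lkerE := lker_arcs tA tC.
have h1 : [forall i, (t @: upto (vflag e) i <= below (vflag e) i)%VS].
  apply/forallP => i; rewrite uptoE belowE !fl_vflag ?(ltnW (ltn_ord i)) // limgE.
  apply: spanV_sub => v vd /mapP[ar]; rewrite mem_filter => /andP[lt arP] ->.
  apply: mem_spanV; first by case/andP: (lcmatch_down arP).
  by have := lcmatch_lt arP; rewrite /= ltnS in lt; move/leq_trans; apply.
have limgF : limg t = spanV e opening.
  by rewrite -spanV_full limgE filter_predT.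
have h2 : (limg t <= spanV e (down d a) <= lker t)%VS.
  rewrite limgF lkerE; apply/andP; split; apply: spanV_sub => v vd vP.
    apply: mem_spanV => //; case/mapP: vP => ar /lcmatch_down/andP[_ ?] -> //.
  apply: mem_spanV => //=; apply: contraL vP => /mapP[ar /lcmatch_up/andP[_ ?] ->] //.
exists (TPV vflag_is_flag h1 h2).
set x := TPV _ _ _; split=> //.
- apply/and3P; split; apply/eqP; apply: (@alpha_eq _ _ _ _ _ x) => i ik /=.
  + rewrite fl_vflag // spanV_cap_dim /psum -(count_down had).
    by apply: eq_count => v /=; rewrite andbC.
  + rewrite limgF fl_vflag // spanV_cap_dim.
    have := count_opening predT (fun v => v.1 < i); rewrite filter_predT => ->.
    apply: etrans (esym (sum_count_box (fun ar : vertex k * vertex k => ar.1.1)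
      (lcmatch d a) (fun l => l < i))) _.
    by apply: eq_bigr => l _; rewrite ffunE.
  + rewrite lkerE fl_vflag // spanV_cap_dim.
    have cA : count (predI closing (fun v => v.1 < i)) (vertices d) =
      psum (match_u d a) i by rewrite count_closing psum_match_u.
    have cT : count (fun v : vertex k => v.1 < i) (vertices d) = psum d i.
      exact: (count_box d (fun l : 'I_k => l < i)).
    have cS : psum d i = psum (match_n d a) i + psum (match_u d a) i.
      rewrite /psum -big_split; apply: eq_bigr => l _ /=; rewrite match_nE subnK //.
      rewrite match_u_rec //; exact: leq_trans (geq_minl _ _) (leq_subr _ _).
    have := count_predC closing [seq v : vertex k <- vertices d | v.1 < i].
    rewrite !count_filter size_filter cT cS addnC => /eqP.
    by rewrite -cA eqn_add2r => /eqP.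
(* Beyond [D_p], the sum is spanned by the left endpoints, in box [p] or later, of the arcs that end
   before box [q]. *)
- move=> p q pk qk /=; rewrite !fl_vflag // limgE -spanVU spanV_dim.
  have -> : psum d p = count (fun v : vertex k => v.1 < p) (vertices d).
    exact/esym/(count_box d (fun l : 'I_k => l < p)).
  have := count_opening (fun ar => ar.2.1 < q) (fun v => p <= v.1).
  have -> : count (fun ar : vertex k * vertex k => (ar.2.1 < q) && (p <= ar.1.1))
     (lcmatch d a) = arcs_in d a p q by apply: eq_count => ar; rewrite andbC.
  move=> <-; set M := map fst _.
  rewrite -(count_predUI (fun v : vertex k => v.1 < p)) [X in _ = _ + X](eq_count (a2 := pred0)) => [|v /=]; last by lia.
  rewrite count_pred0 addn0; apply: eq_count => v /=.
  by case: (v \in M) => //=; case: ltnP.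
Qed.

End Basis.

(** Provides a function on [l] whose values are the prescribed list [C]. *)
Lemma map_nth_index (T : eqType) (U : Type) (u0 : U) (l : seq T) (C : seq U) :
  uniq l -> size C = size l -> [seq nth u0 C (index v l) | v <- l] = C.
Proof.
move=> ul sz; apply: (@eq_from_nth _ u0); rewrite size_map // => i il.
case: l ul sz il => // v0 l ul sz il.
by rewrite (nth_map v0) // index_uniq.
Qed.

Lemma count_vbox (i : 'I_k) (P : pred (vertex k)) :
  count (fun v => (v.1 == i) && P v) (vertices d) =
  count P [seq v <- vertices d | v.1 == i].
Proof. by rewrite count_filter; apply: eq_count => v /=; rewrite andbC. Qed.

(* Basis vectors attached to box [i] complete [N :&: D_i] to [N :&: D_(i+1)]
   at the vertices outside [closing], then [D_i] to [D_(i+1)] at the others. *)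
Lemma adapted_basis (a : {ffun 'I_k -> nat}) (x : tpv V d) :
    (forall i, a i <= d i) -> \dim {:V} = \sum_i d i ->
    alpha (lker (endo x)) (flag x) = match_n d a ->
  exists e, [/\ basis_of fullv [seq e v | v <- vertices d], flag x = vflag e &
    lker (endo x) = spanV e (predC (closing a))].
Proof.
move=> had hD; set N := lker _; set D := fl (flag x) => hN.
pose c := closing a.
pose bc (i : 'I_k) := [seq v <- vertices d | (v.1 == i) && c v].
pose bn (i : 'I_k) := [seq v <- vertices d | (v.1 == i) && ~~ c v].
pose U1 (i : 'I_k) := ((N :&: D i.+1) :\: D i)%VS.
pose U2 (i : 'I_k) := (D i.+1 :\: (D i + N :&: D i.+1))%VS.
have DS (i : 'I_k) : (D i <= D i.+1)%VS by apply: fl_mono.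
have E1 (i : 'I_k) : (U1 i + N :&: D i = N :&: D i.+1)%VS.
  rewrite -[RHS](addv_diff_cap _ (D i)) -capvA [(D i.+1 :&: _)%VS]capvC.
  by rewrite (capv_idPl (DS i)).
have E2 (i : 'I_k) : (U2 i + (D i + N :&: D i.+1) = D i.+1)%VS.
  rewrite addv_diff; apply/addv_idPl.
  by rewrite subv_add DS capvSr.
have szc (i : 'I_k) : size (bc i) = match_u d a i.
  rewrite size_filter ffunE; have := count_closing a (fun v => v.1 == i) => <-.
  by apply: eq_count => v /=; rewrite andbC.
have szn (i : 'I_k) : size (bn i) = match_n d a i.
  have E0 : size (bc i) + size (bn i) = d i.
    rewrite !size_filter !count_vbox; apply: etrans (count_predC c _) _.
    by rewrite size_filter (count_box d (pred1 i)) big_pred1_eq.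
  by rewrite match_nE -szc -E0 addKn.
have dim1 (i : 'I_k) : \dim (U1 i) = match_n d a i.
  rewrite -hN ffunE belowE uptoE -/D.
  have := dimv_cap_compl (N :&: D i.+1) (D i); rewrite -capvA [(D i.+1 :&: _)%VS]capvC.
  by rewrite (capv_idPl (DS i)) -/(U1 i) => <-; rewrite addKn.
have dimD (i : 'I_k) : \dim (D i.+1) = \dim (D i) + d i.
  by rewrite !fl_dim ?psumS // ltnW.
(* [D_i] and [N :&: D_(i+1)] meet in [N :&: D_i], so the complement has dimension
   [d i - match_n d a i]. *)
have dim2 (i : 'I_k) : \dim (U2 i) = match_u d a i.
  have := dimv_cap_compl (D i.+1) (D i + N :&: D i.+1).
  have /capv_idPr -> : (D i + N :&: D i.+1 <= D i.+1)%VS by rewrite subv_add DS capvSr.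
  rewrite -/(U2 i) dimD; have := dimv_sum_cap (D i) (N :&: D i.+1).
  have -> : (D i :&: (N :&: D i.+1) = N :&: D i)%VS.
    by rewrite capvC -capvA [(D i.+1 :&: _)%VS]capvC (capv_idPl (DS i)).
  have := dimv_cap_compl (N :&: D i.+1) (D i); rewrite -capvA [(D i.+1 :&: _)%VS]capvC.
  rewrite (capv_idPl (DS i)) -/(U1 i) dim1 match_nE.
  have : match_u d a i <= d i by rewrite match_u_rec //; have := had i; lia.
  lia.
pose e v := if c v then nth 0%R (vbasis (U2 v.1)) (index v (bc v.1))
            else nth 0%R (vbasis (U1 v.1)) (index v (bn v.1)).
have spc (i : 'I_k) : spanV e (fun v => (v.1 == i) && c v) = U2 i.
  rewrite /spanV -/(bc i) -[RHS](span_basis (vbasisP _)); congr (<<_>>%VS).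
  rewrite (_ : map e _ = [seq nth 0%R (vbasis (U2 i)) (index v (bc i)) | v <- bc i]).
    by apply: map_nth_index; rewrite ?filter_uniq ?vertices_uniq // size_tuple dim2 szc.
  apply/eq_in_map => v; rewrite mem_filter => /andP[/andP[/eqP vi cv] _].
  by rewrite /e cv vi.
have spn (i : 'I_k) : spanV e (fun v => (v.1 == i) && ~~ c v) = U1 i.
  rewrite /spanV -/(bn i) -[RHS](span_basis (vbasisP _)); congr (<<_>>%VS).
  rewrite (_ : map e _ = [seq nth 0%R (vbasis (U1 i)) (index v (bn i)) | v <- bn i]).
    by apply: map_nth_index; rewrite ?filter_uniq ?vertices_uniq // size_tuple dim1 szn.
  apply/eq_in_map => v; rewrite mem_filter => /andP[/andP[/eqP vi cv] _].
  by rewrite /e (negbTE cv) vi.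
have ND i : i <= k -> spanV e (fun v => (v.1 < i) && ~~ c v) = (N :&: D i)%VS.
  elim: i => [|i IH] ik.
    by rewrite /D fl0 capv0 /spanV filter_pred0 span_nil.
  have := E1 (Ordinal ik) => /= <-; rewrite -IH ?(ltnW ik) // -spn -spanVU.
  apply: eq_spanV => v _ /=; rewrite -val_eqE /= ltnS leq_eqVlt.
  exact: andb_orl.
have DD i : i <= k -> spanV e (fun v => v.1 < i) = D i.
  elim: i => [|i IH] ik.
    by rewrite /D fl0 /spanV filter_pred0 span_nil.
  have := E2 (Ordinal ik) => /= <-; rewrite -(IH (ltnW ik)) -spc -ND // -!spanVU.
  apply: eq_spanV => v _ /=; rewrite -val_eqE /= ltnS leq_eqVlt.
  by case: (_ == _) (_ < _) (c v) => -[] [].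
have full : spanV e predT = fullv.
  rewrite -(flk x) -/D -DD //; apply: eq_spanV => v _ /=; by rewrite ltn_ord.
exists e; split.
- rewrite basisEdim hD size_map size_vertices leqnn andbT -full /spanV filter_predT.
  exact: subvv.
- by apply: eq_fl => i ik; rewrite fl_vflag // DD.
- rewrite -[N]capvf -(flk x) -/D -ND //; apply: eq_spanV => v _ /=.
  by rewrite ltn_ord.
Qed.

Lemma basis_exists : \dim {:V} = \sum_i d i ->
  exists e, basis_of fullv [seq e v | v <- vertices d].
Proof.
move=> hD; exists (fun v => nth 0%R (vbasis fullv) (index v (vertices d))).
by rewrite map_nth_index ?vbasisP ?vertices_uniq // size_tuple size_vertices.
Qed.

End Adapted.

(** * Ranks in homogeneous coordinates *)

Section Rows.
Variables (K : fieldType) (n : nat).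
Implicit Types (m r : nat).

Lemma mem_rows m (M : 'M[K]_(m, n)) (v : 'rV[K]_n) :
  (v \in <<rows_of M>>%VS) = (v <= M)%MS.
Proof.
apply/idP/idP => [|/submxP[u ->]].
  have : (<<rows_of M>> <= limg (linfun (mulmxr M)))%VS.
    apply/span_subvP => w /mapP[j _ ->]; rewrite rowE.
    have -> : delta_mx 0 j *m M = linfun (mulmxr M) (delta_mx (0 : 'I_1) j).
      by rewrite lfunE.
    exact: memv_img (memvf _).
  by move/subvP=> H /H /memv_imgP[u _ ->]; rewrite lfunE /= submxMl.
rewrite mulmx_sum_row; apply: rpred_sum => j _; apply: rpredZ.
by apply/memv_span/map_f; rewrite mem_enum.
Qed.

Lemma rows_matrix m (L : seq 'rV[K]_n) : size L = m ->
  rows_of (\matrix_(i < m) L`_i) = L.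
Proof.
move=> szL; apply: (@eq_from_nth _ 0); rewrite size_map size_enum_ord // => i im.
by rewrite (nth_map (Ordinal im)) ?size_enum_ord // rowK nth_enum_ord.
Qed.

Lemma eq_rows m r (A : 'M[K]_(m, n)) (B : 'M[K]_(r, n)) :
  (A :=: B)%MS -> <<rows_of A>>%VS = <<rows_of B>>%VS.
Proof. by move=> AB; apply/vspaceP => v; rewrite !mem_rows AB. Qed.

(** A row base bounds the dimension by the rank; a basis of the span, put into a matrix with as many
    rows, bounds the rank by the dimension. *)
Lemma rows_rank m (M : 'M[K]_(m, n)) : \dim <<rows_of M>> = \rank M.
Proof.
apply/eqP; rewrite eqn_leq; apply/andP; split.
  rewrite -(eq_rows (eq_row_base M)) (leq_trans (dim_span _)) //.
  by rewrite size_map size_enum_ord.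
set U := <<_>>%VS; pose B := \matrix_(i < \dim U) (vbasis U)`_i.
have BU : <<rows_of B>>%VS = U.
  by rewrite rows_matrix ?size_tuple // (span_basis (vbasisP U)).
apply: leq_trans (rank_leq_row B); apply: mxrankS; apply/row_subP => i.
by rewrite -mem_rows BU mem_rows row_sub.
Qed.

Lemma rows_col m r (A : 'M[K]_(m, n)) (B : 'M[K]_(r, n)) :
  <<rows_of (col_mx A B)>>%VS = (<<rows_of A>> + <<rows_of B>>)%VS.
Proof.
apply/eqP; rewrite eqEsubv subv_add; apply/and3P; split; last 2 first.
- by apply/subvP => v; rewrite !mem_rows => /submx_trans->//; rewrite -addsmxE addsmxSl.
- by apply/subvP => v; rewrite !mem_rows => /submx_trans->//; rewrite -addsmxE addsmxSr.
apply/subvP => v; rewrite mem_rows -addsmxE => /sub_addsmxP[[u w] /= ->].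
by apply: memv_add; rewrite mem_rows submxMl.
Qed.

Lemma rows_img m (A : 'M[K]_(m, n)) (f : 'End('rV[K]_n)) :
  (f @: <<rows_of A>>)%VS = <<rows_of (A *m lin1_mx f)>>%VS.
Proof.
rewrite limg_span /rows_of -map_comp; congr (<<_>>%VS); apply: eq_map => j /=.
by rewrite row_mul mul_rV_lin1.
Qed.

(** Truncation by [pid_mx] is linear in [g] and keeps the size of the matrix, so it also applies to
    matrices of polynomials. *)
Lemma rows_take m r (g : 'M[K]_(m, n)) :
  <<take r (rows_of g)>>%VS = <<rows_of (pid_mx r *m g : 'M_(m, n))>>%VS.
Proof.
have rowE j : row j (pid_mx r *m g : 'M_(m, n)) = if (j < r)%N then row j g else 0.
  rewrite row_mul; apply/rowP => l; rewrite mxE (bigD1 j) //= big1 => [|i ij].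
    by rewrite !mxE eqxx addr0; case: ltnP; rewrite /= ?mul1r ?mul0r ?mxE.
  by rewrite !mxE val_eqE eq_sym (negbTE ij) mul0r.
apply/eqP; rewrite eqEsubv; apply/andP; split; apply/span_subvP => v.
  case/(nthP 0) => i; rewrite size_take_min size_map size_enum_ord leq_min.
  case/andP=> ir im <-; rewrite nth_take // (nth_map (Ordinal im)) ?size_enum_ord //.
  have -> : nth (Ordinal im) (enum 'I_m) i = Ordinal im.
    by apply: val_inj; rewrite /= nth_enum_ord.
  by rewrite mem_rows; have := rowE (Ordinal im); rewrite /= ir => <-; apply: row_sub.
case/mapP=> j _ ->; rewrite rowE; case: ltnP => jr; last exact: mem0v.
apply: memv_span; have -> : row j g = (take r (rows_of g))`_j.
  by rewrite nth_take // (nth_map j) ?size_enum_ord // nth_ord_enum.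
by rewrite mem_nth // size_take_min size_map size_enum_ord leq_min jr ltn_ord.
Qed.

End Rows.

(** * Rank and nonzero minors *)

Section Minors.
Variable K : fieldType.

(** Choose [r] independent rows, then [r] independent columns of the matrix they form. *)
Lemma rank_minor m n (A : 'M[K]_(m, n)) r : (r <= \rank A)%N ->
  exists (f : 'I_r -> 'I_m) (h : 'I_r -> 'I_n), \det (mxsub f h A) != 0.
Proof.
move=> rA; pose w := widen_ord rA; pose f := maxrankfun A \o w.
have fr : row_free (rowsub f A).
  have /row_freeP[S hS] := maxrowsub_free A.
  apply/row_freeP; exists (S *m (rowsub w 1%:M)^T).
  rewrite /f rowsub_comp mulmxA mul_rowsub_mx hS.
  apply/matrixP => i j; rewrite !mxE (bigD1 (w i)) //= big1 => [|l li].
    by rewrite !mxE eqxx mul1r addr0 -!val_eqE /= eq_sym.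
  by rewrite !mxE eq_sym (negbTE li) mul0r.
have full : row_full (rowsub f A)^T by rewrite /row_full mxrank_tr.
exists f, (fullrankfun full).
have := fullrowsub_unit full; rewrite unitmxE unitfE -det_tr.
suff -> : (rowsub (fullrankfun full) (rowsub f A)^T)^T = mxsub f (fullrankfun full) A.
  by [].
by apply/matrixP => i j; rewrite !mxE.
Qed.

Lemma minor_rank m n (A : 'M[K]_(m, n)) r (f : 'I_r -> 'I_m) (h : 'I_r -> 'I_n) :
  \det (mxsub f h A) != 0 -> (r <= \rank A)%N.
Proof.
rewrite -unitfE -unitmxE -row_free_unit => /eqP {1}<-.
have -> : mxsub f h A = rowsub f 1%:M *m A *m colsub h 1%:M.
  by rewrite mul_rowsub_mx mul1mx mulmx_colsub mulmx1 -mxsub_comp.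
exact: leq_trans (mxrankM_maxl _ _) (mxrankM_maxr _ _).
Qed.

End Minors.

(** * Rank conditions as closed conditions in homogeneous coordinates *)

Section Coordinates.
Variables (K : fieldType) (n k : nat) (d : {ffun 'I_k -> nat}).
Local Notation T := (tpv 'rV[K]_n d).

Lemma coordinates_fl (x : T) g m (B : 'M_(m, n)) i : coordinates x g B ->
  (i <= k)%N -> fl (flag x) i = <<rows_of (pid_mx (psum d i) *m g : 'M_n)>>%VS.
Proof.
by case=> _ gf _ ik; rewrite -rows_take -(fl_dim x ik) /fl gf -gf.
Qed.

Lemma coordinates_mid (x : T) g m (B : 'M_(m, n)) : coordinates x g B ->
  mid x = <<rows_of B>>%VS.
Proof. by case=> _ _ /span_basis. Qed.

Lemma coordinates_dim (x : T) g m (B : 'M_(m, n)) : coordinates x g B ->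
  \dim (mid x) = m.
Proof.
by case=> _ _ B'; rewrite -(span_basis B') (eqP (basis_free B')) size_map size_enum_ord.
Qed.

(** The rows span [W + D_i], and those of [endo_mx] span [t D_q + D_p]. The ring is a parameter: the
    field itself, polynomials in all coordinates for closedness, or polynomials in one variable for
    families. *)
Definition mid_mx (A : comNzRingType) m (i : nat) (g : 'M[A]_n) (B : 'M[A]_(m, n)) :=
  col_mx B (pid_mx (psum d i) *m g : 'M_n).

Definition endo_mx (A : comNzRingType) (p q : nat) (g T : 'M[A]_n) :=
  col_mx (pid_mx (psum d q) *m g *m T : 'M_n) (pid_mx (psum d p) *m g : 'M_n).

Lemma map_mid_mx (A A' : comNzRingType) (f : {rmorphism A -> A'}) m i g
    (B : 'M[A]_(m, n)) :
  map_mx f (mid_mx i g B) = mid_mx i (map_mx f g) (map_mx f B).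
Proof. by rewrite map_col_mx map_mxM map_pid_mx. Qed.

Lemma map_endo_mx (A A' : comNzRingType) (f : {rmorphism A -> A'}) p q g t :
  map_mx f (endo_mx p q g t) = endo_mx p q (map_mx f g) (map_mx f t).
Proof. by rewrite map_col_mx !map_mxM !map_pid_mx. Qed.

Lemma mid_mx_rank (x : T) g m (B : 'M_(m, n)) i : coordinates x g B ->
  (i <= k)%N -> \dim (mid x + fl (flag x) i) = \rank (mid_mx i g B).
Proof.
move=> co ik; rewrite (coordinates_fl co ik) (coordinates_mid co) -rows_col.
exact: rows_rank.
Qed.

Lemma endo_mx_rank (x : T) g m (B : 'M_(m, n)) p q : coordinates x g B ->
    (p <= k)%N -> (q <= k)%N ->
  \dim (endo x @: fl (flag x) q + fl (flag x) p) =
    \rank (endo_mx p q g (lin1_mx (endo x))).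
Proof.
move=> co pk qk; rewrite !(coordinates_fl co) // rows_img -rows_col.
exact: rows_rank.
Qed.

Section Closed.
Variable m : nat.
Local Notation N := ((n + (m + n)) * n)%N.

(** The matrix of coordinate functions; its blocks are the generic [g], [B] and matrix of [t],
    stacked as in [affine_point]. *)
Definition generic_mx : 'M[{mpoly K[N]}]_(n + (m + n), n) := vec_mx (\row_i 'X_i).

Lemma generic_mxE (A : 'M[K]_(n + (m + n), n)) :
  map_mx (meval (mxvec A 0)) generic_mx = A.
Proof.
rewrite map_vec_mx -[RHS]mxvecK; congr vec_mx.
by apply/rowP => i; rewrite !mxE mevalXU.
Qed.

Lemma generic_g (x : T) (g : 'M_n) (B : 'M_(m, n)) :
  map_mx (meval (affine_point x g B 0)) (usubmx generic_mx) = g.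
Proof. by rewrite map_usubmx generic_mxE col_mxKu. Qed.

Lemma generic_B (x : T) (g : 'M_n) (B : 'M_(m, n)) :
  map_mx (meval (affine_point x g B 0)) (usubmx (dsubmx generic_mx)) = B.
Proof. by rewrite map_usubmx map_dsubmx generic_mxE col_mxKd col_mxKu. Qed.

Lemma generic_T (x : T) (g : 'M_n) (B : 'M_(m, n)) :
  map_mx (meval (affine_point x g B 0)) (dsubmx (dsubmx generic_mx)) =
    lin1_mx (endo x).
Proof. by rewrite !map_dsubmx generic_mxE !col_mxKd. Qed.

End Closed.

(** A rank is at most [c] exactly when all minors of size [c.+1] vanish, and these are polynomials
    in the coordinates. *)
Lemma closed_rank (phi : T -> nat) (c : nat) (r : nat -> nat)
    (M : forall m, 'M[{mpoly K[(n + (m + n)) * n]}]_(r m, n)) :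
    (forall x g m (B : 'M_(m, n)), coordinates x g B ->
      phi x = \rank (map_mx (meval (affine_point x g B 0)) (M m))) ->
  zariski_closed (fun x => phi x <= c)%N.
Proof.
move=> phiE m.
exists (fun p => exists (f : 'I_c.+1 -> _) (h : 'I_c.+1 -> _), p = \det (mxsub f h (M m))).
move=> x g B co; rewrite (phiE _ _ _ _ co); split=> [le p [f [h ->]]|H].
  apply/eqP; apply: contraTT le; rewrite -ltnNge -det_map_mx map_mxsub.
  exact: minor_rank.
rewrite leqNgt; apply/negP => /rank_minor[f [h]].
by rewrite -map_mxsub det_map_mx /= H ?eqxx //; exists f, h.
Qed.

(** Closedness is tested for each [m] separately: no equation for [m = w], the equation [1 = 0] for
    the others. *)
Lemma closed_dim_mid w : zariski_closed (fun x : T => \dim (mid x) = w).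
Proof.
move=> m; exists (fun p => m <> w /\ p = 1) => x g B co; rewrite (coordinates_dim co).
split=> [mw p [/(_ mw)] //|H]; apply/eqP; apply/negPn/negP => /eqP ne.
by have /eqP := H 1 (conj ne erefl); rewrite meval1 oner_eq0.
Qed.

Lemma closed_mid i c : (i <= k)%N ->
  zariski_closed (fun x : T => \dim (mid x + fl (flag x) i) <= c)%N.
Proof.
move=> ik; apply: (@closed_rank (fun x => \dim (mid x + fl (flag x) i)) c _
  (fun m => mid_mx i (usubmx (generic_mx m)) (usubmx (dsubmx (generic_mx m))))).
by move=> x g m B co; rewrite map_mid_mx generic_g generic_B (mid_mx_rank co).
Qed.

Lemma closed_endo p q c : (p <= k)%N -> (q <= k)%N ->
  zariski_closed (fun x : T => \dim (endo x @: fl (flag x) q + fl (flag x) p) <= c)%N.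
Proof.
move=> pk qk.
apply: (@closed_rank (fun x => \dim (endo x @: fl (flag x) q + fl (flag x) p)) c _
  (fun m => endo_mx p q (usubmx (generic_mx m)) (dsubmx (dsubmx (generic_mx m))))).
by move=> x g m B co; rewrite map_endo_mx generic_g generic_T (endo_mx_rank co).
Qed.

Lemma dim_rV : \dim {:'rV[K]_n} = n.
Proof. by rewrite dimvf dim_matrix; apply: mul1n. Qed.

Lemma coordinates_exist (x : T) (e : vertex k -> 'rV[K]_n) m (B : 'M[K]_(m, n)) :
    basis_of fullv [seq e v | v <- vertices d] -> flag x = vflag d e ->
    basis_of (mid x) (rows_of B) ->
  coordinates x (\matrix_(i < n) [seq e v | v <- vertices d]`_i) B.
Proof.
move=> eB fx BB; set L := [seq e v | v <- vertices d].
have szL : size L = n.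
  by rewrite -(eqP (basis_free eB)) (span_basis eB) dim_rV.
split=> //.
  rewrite -row_free_unit /row_free -rows_rank rows_matrix // (span_basis eB).
  by rewrite dim_rV.
move=> i; have ik : (i <= k)%N by rewrite -ltnS.
by rewrite rows_matrix // flE fl_dim // fx vflag_take.
Qed.

End Coordinates.

(** * One-parameter families *)

Lemma meval_line (K : comNzRingType) N (v w : 'I_N -> K) (p : {mpoly K[N]}) :
  exists P : {poly K}, forall s, P.[s] = p.@[fun i => v i + s * w i].
Proof.
elim/mpolyind: p => [|c m p _ _ [P PE]].
  by exists 0 => s; rewrite horner0 meval0.
exists (c%:P * \prod_i ((v i)%:P + 'X * (w i)%:P) ^+ m i + P) => s.
rewrite mevalD mevalZ mevalX hornerD hornerM hornerC PE horner_prod.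
congr (_ * _ + _); apply: eq_bigr => i _.
by rewrite horner_exp !hornerE.
Qed.

Definition line_mx (K : comNzRingType) m n (A B : 'M[K]_(m, n)) : 'M[{poly K}]_(m, n) :=
  map_mx polyC A + 'X *: map_mx polyC (B - A).

Lemma line_mxE (K : comNzRingType) m n (A B : 'M[K]_(m, n)) s :
  map_mx (horner_eval s) (line_mx A B) = A + s *: (B - A).
Proof. by apply/matrixP => i j; rewrite !mxE /horner_eval !hornerE. Qed.

(** [Q] is a minor of maximal size that is nonzero at [s0]; the rank cannot drop where it stays
    nonzero. *)
Lemma rank_generic (K : fieldType) m n (M : 'M[{poly K}]_(m, n)) s0 :
  exists2 Q : {poly K}, Q.[s0] != 0 & forall s, Q.[s] != 0 ->
    (\rank (map_mx (horner_eval s0) M) <= \rank (map_mx (horner_eval s) M))%N.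
Proof.
have [f [h]] := rank_minor (leqnn (\rank (map_mx (horner_eval s0) M))).
rewrite -map_mxsub det_map_mx => nz; exists (\det (mxsub f h M)) => // s nzs.
by apply: (@minor_rank _ _ _ _ _ f h); rewrite -map_mxsub det_map_mx.
Qed.

Lemma rank_generic_fin (K : fieldType) (I : finType) m n
    (M : I -> 'M[{poly K}]_(m, n)) s0 :
  exists2 Q : {poly K}, Q.[s0] != 0 & forall s, Q.[s] != 0 -> forall i,
    (\rank (map_mx (horner_eval s0) (M i)) <= \rank (map_mx (horner_eval s) (M i)))%N.
Proof.
have H i : exists Q : {poly K}, Q.[s0] != 0 /\ forall s, Q.[s] != 0 ->
    (\rank (map_mx (horner_eval s0) (M i)) <= \rank (map_mx (horner_eval s) (M i)))%N.
  by have [Q Q0 QP] := rank_generic (M i) s0; exists Q.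
have [Q QP] := fin_all_exists H.
exists (\prod_i Q i) => [|s]; rewrite horner_prod.
  by apply/prodf_neq0 => i _; case: (QP i).
by move/prodf_neq0=> nz i; case: (QP i) => _; apply; apply: nz.
Qed.

(** * Joining two points with the same flag and the same kernel *)

Section Deformation.
Variables (K : closedFieldType) (n k : nat) (d : {ffun 'I_k -> nat}).
Local Notation T := (tpv 'rV[K]_n d).
Implicit Types (x y : T).

(* The images of a fixed complement of the kernel come first, so that, for two
   points with the same kernel, interpolating the sequences and the
   endomorphisms keeps the image inside the span of the sequence. *)
Definition mid_seq (x : T) : seq 'rV[K]_n :=
  [seq endo x v | v <- vbasis (lker (endo x))^C] ++
    vbasis (mid x :\: limg (endo x))%VS.

Lemma limg_compl (f : 'End('rV[K]_n)) (N : {vspace 'rV[K]_n}) :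
  (N <= lker f)%VS -> limg f = <<[seq f v | v <- vbasis N^C]>>%VS.
Proof.
move=> Nf; rewrite -limg_span (span_basis (vbasisP _)) -(addv_complf N) limgD.
by move: Nf; rewrite lkerE => /eqP ->; rewrite add0v.
Qed.

Lemma mid_seq_basis x : basis_of (mid x) (mid_seq x).
Proof.
rewrite basisEdim /mid_seq span_cat -(limg_compl (subvv _)).
rewrite (span_basis (vbasisP _)) size_cat size_map !size_tuple dimv_compl.
have h := limg_mid x; rewrite -{1}(addv_diff_cap (mid x) (limg (endo x))).
rewrite (capv_idPr h) addvC subvv /=.
have := dimv_cap_compl (mid x) (limg (endo x)); rewrite (capv_idPr h).
by have := limg_ker_dim (endo x) fullv; rewrite capfv; lia.
Qed.

(* [x] is joined to [x1] by the family [endo x + s *: (endo x1 - endo x)],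
   along which the ranks are at least those of [x1] for all but finitely many
   [s]. *)
Lemma deformation_closure (A : T -> Prop) x x1 (e : vertex k -> 'rV[K]_n) :
    basis_of fullv [seq e v | v <- vertices d] -> flag x = vflag d e ->
    flag x1 = flag x -> lker (endo x1) = lker (endo x) ->
    \dim (mid x1) = \dim (mid x) ->
    (forall y, flag y = flag x -> \dim (mid y) = \dim (mid x) ->
      (forall i, (i <= k)%N ->
        \dim (mid x1 + fl (flag x) i) <= \dim (mid y + fl (flag x) i))%N ->
      (forall p q, (p <= k)%N -> (q <= k)%N ->
        \dim (endo x1 @: fl (flag x) q + fl (flag x) p) <=
          \dim (endo y @: fl (flag x) q + fl (flag x) p))%N -> A y) ->
  zariski_closure A x.
Proof.
move=> eB fx f1 k1 w1 HA C Ccl AC; pose m := \dim (mid x).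
have [S HS] := Ccl m.
pose N := lker (endo x); pose b := vbasis (N^C)%VS.
pose B0 : 'M_(m, n) := \matrix_(i < m) (mid_seq x)`_i.
pose B1 : 'M_(m, n) := \matrix_(i < m) (mid_seq x1)`_i.
have szm y : size (mid_seq y) = \dim (mid y).
  by have mB := mid_seq_basis y; rewrite -(eqP (basis_free mB)) (span_basis mB).
have rB0 : rows_of B0 = mid_seq x by apply: rows_matrix; rewrite szm.
have rB1 : rows_of B1 = mid_seq x1 by apply: rows_matrix; rewrite szm.
pose g : 'M_n := \matrix_(i < n) [seq e v | v <- vertices d]`_i.
have c0 : coordinates x g B0 by apply: coordinates_exist; rewrite ?rB0 ?mid_seq_basis.
have c1 : coordinates x1 g B1.
  by apply: coordinates_exist; rewrite ?rB1 ?mid_seq_basis // f1.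
pose t s := endo x + s *: (endo x1 - endo x).
have tE s v : t s v = endo x v + s *: (endo x1 v - endo x v).
  by rewrite add_lfunE scale_lfunE add_lfunE opp_lfunE.
pose B s := B0 + s *: (B1 - B0).
have tmx s : lin1_mx (t s) = lin1_mx (endo x) + s *: (lin1_mx (endo x1) - lin1_mx (endo x)).
  by apply/matrixP => i j; rewrite !mxE tE !mxE.
(* The parameter 1 is the point [x1]. Off the roots of [Q1] the rows of [B s] stay independent; off
   those of [Q2] and [Q3] the ranks in the assumption on [A] are at least their values at [x1]. *)
have [Q1 Q1nz Q1P] := rank_generic (line_mx B0 B1) 1.
have [Q2 Q2nz Q2P] := rank_generic_fin
  (fun i : 'I_k.+1 => mid_mx d i (map_mx polyC g) (line_mx B0 B1)) 1.
have [Q3 Q3nz Q3P] := rank_generic_fin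
  (fun pq : 'I_k.+1 * 'I_k.+1 => endo_mx d pq.1 pq.2 (map_mx polyC g)
     (line_mx (lin1_mx (endo x)) (lin1_mx (endo x1)))) 1.
have gE s : map_mx (horner_eval s) (map_mx polyC g) = g.
  by apply/matrixP => i j; rewrite !mxE /horner_eval hornerC.
have one_line (V : lmodType K) (u v : V) : u + 1 *: (v - u) = v.
  by rewrite scale1r addrC subrK.
have Nt s : (N <= lker (t s))%VS.
  apply/subvP => v vN; rewrite memv_ker tE.
  have /eqP -> : endo x v == 0 by rewrite -memv_ker.
  have /eqP -> : endo x1 v == 0 by rewrite -memv_ker k1.
  by rewrite subrr scaler0 addr0.
have rowB s (i : 'I_m) : row i (B s) = (mid_seq x)`_i + s *: ((mid_seq x1)`_i - (mid_seq x)`_i).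
  by apply/rowP => j; rewrite !mxE.
have BN s : (<<rows_of (B s)>> <= N)%VS.
  apply/span_subvP => v /mapP[i _ ->]; rewrite rowB.
  have memN y : N = lker (endo y) -> \dim (mid y) = m -> (mid_seq y)`_i \in N.
    move=> Ny ym; rewrite Ny; apply: (subvP (mid_lker y)).
    by apply: (basis_mem (mid_seq_basis y)); rewrite mem_nth // szm ym.
  by rewrite rpredD ?rpredZ ?rpredB ?memN.
have szb : (size b <= m)%N.
  by rewrite /m -szm /mid_seq size_cat size_map leq_addr.
have tB s : (limg (t s) <= <<rows_of (B s)>>)%VS.
  rewrite (limg_compl (Nt s)); apply/span_subvP => _ /mapP[v vb ->].
  have ib : (index v b < size b)%N by rewrite index_mem.
  have im := leq_trans ib szb.
  have midE y : lker (endo y) = N -> (mid_seq y)`_(index v b) = endo y v.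
    move=> Ny; rewrite /mid_seq Ny nth_cat size_map ib (nth_map 0) //.
    by rewrite nth_index.
  suff -> : t s v = row (Ordinal im) (B s) by apply/memv_span/map_f; rewrite mem_enum.
  by rewrite rowB tE !midE.
have tfl s i : (i < k)%N -> (t s @: fl (flag x) i.+1 <= fl (flag x) i)%VS.
  move=> ik; apply/subvP => _ /memv_imgP[v vD ->]; rewrite tE.
  have h : endo x v \in fl (flag x) i.
    by apply: (subvP (endo_fl x ik)); apply: memv_img.
  have h1 : endo x1 v \in fl (flag x) i.
    by rewrite -f1; apply: (subvP (endo_fl x1 ik)); apply: memv_img; rewrite f1.
  by rewrite rpredD ?rpredZ ?rpredB.
pose Q := Q1 * Q2 * Q3.
have Qnz : Q.[1] != 0 by rewrite !hornerM !mulf_neq0.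
have good s : Q.[s] != 0 -> exists2 y, A y & coordinates y g (B s) /\ endo y = t s.
  rewrite !hornerM !mulf_eq0 !negb_or => /andP[/andP[q1 q2] q3].
  have rkB : \dim <<rows_of (B s)>> = m.
    apply/eqP; rewrite eqn_leq rows_rank rank_leq_row /=.
    have := Q1P s q1; rewrite !line_mxE one_line; apply: leq_trans.
    by rewrite -rows_rank rB1 (span_basis (mid_seq_basis x1)) w1.
  have h1 : [forall i, (t s @: upto (flag x) i <= below (flag x) i)%VS].
    by apply/forallP => i; rewrite uptoE belowE tfl.
  have h2 : (limg (t s) <= <<rows_of (B s)>> <= lker (t s))%VS.
    by rewrite tB; apply: subv_trans (BN s) (Nt s).
  pose y := TPV (flagP x) h1 h2.
  have cy : coordinates y g (B s).
    apply: (coordinates_exist eB) => //=.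
    by rewrite basisEdim subvv rkB /= size_map size_enum_ord.
  exists y => //; apply: HA => // [i ik|p q pk qk].
    have := Q2P s q2 (Ordinal (ik : (i < k.+1)%N)).
    rewrite !map_mid_mx !line_mxE !gE one_line /=.
    by rewrite -(mid_mx_rank c1 ik) -(mid_mx_rank cy ik) /= f1.
  have := Q3P s q3 (Ordinal (pk : (p < k.+1)%N), Ordinal (qk : (q < k.+1)%N)).
  rewrite !map_endo_mx !line_mxE !gE one_line /= -tmx.
  by rewrite -(endo_mx_rank c1 pk qk) -(endo_mx_rank cy pk qk) /= f1.
apply/(HS x g B0 c0) => p pS.
pose v := affine_point x g B0 0; pose w := affine_point x1 g B1 0.
have [P PE] := meval_line v (fun i => w i - v i) p.
(* An algebraically closed field is infinite, so a nonzero [P * Q] has a nonroot [s]; the family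
   then has a point of [A] at [s], where [p] vanishes. *)
have P0 : P = 0.
  apply/eqP; apply: contraT => Pnz.
  have Qn0 : Q != 0 by apply: contraNneq Qnz => ->; rewrite horner0.
  have /closed_nonrootP[s] : P * Q != 0 by rewrite mulf_neq0.
  rewrite /root hornerM mulf_eq0 negb_or => /andP[Ps Qs].
  have [y Ay [cy ty]] := good s Qs.
  have := (HS y g (B s) cy).1 (AC y Ay) p pS.
  suff -> : p.@[affine_point y g (B s) 0] = P.[s] by move/eqP; rewrite (negbTE Ps).
  rewrite PE; apply: meval_eq => i.
  have -> : affine_point y g (B s) = affine_point x g B0 +
     s *: (affine_point x1 g B1 - affine_point x g B0).
    rewrite /affine_point ty tmx -linearB -linearZ -linearD /=; congr mxvec.
    rewrite !opp_col_mx !add_col_mx !scale_col_mx !add_col_mx subrr scaler0 addr0.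
    by [].
  by rewrite !mxE.
(* The parameter 0 is the point [x]. *)
have := PE 0; rewrite P0 horner0 => ->; apply: meval_eq => i.
by rewrite mul0r addr0.
Qed.

End Deformation.

(** * Extension of scalars *)

Section BaseChange.
Variables (F K : fieldType) (iota : {rmorphism F -> K}) (V : vectType F).
Local Notation VK := 'rV[K]_(\dim {:V}).
Local Notation b := (vbasis {:V}).
Local Notation ext := (@ext_vec F K iota V).
Local Notation exts := (@ext_sub F K iota V).
Implicit Types (U W : {vspace V}).

Lemma ext_vecE v : ext v = map_mx iota (rVof b v).
Proof. by apply/rowP => i; rewrite !mxE. Qed.

Lemma ext_vecD u v : ext (u + v) = ext u + ext v.
Proof. by rewrite !ext_vecE linearD map_mxD. Qed.

Lemma ext_vecZ c v : ext (c *: v) = iota c *: ext v.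
Proof. by rewrite !ext_vecE linearZ map_mxZ. Qed.

Lemma ext_vec_span (X : seq V) v : v \in <<X>>%VS -> ext v \in <<map ext X>>%VS.
Proof.
rewrite -{1}[X]in_tupleE => /coord_span ->.
have ext0 : ext 0 = 0 by rewrite -(scale0r 0) ext_vecZ rmorph0 scale0r.
elim/big_ind: _ => [|u w uX wX|i _]; first by rewrite ext0 mem0v.
  by rewrite ext_vecD memvD.
by rewrite ext_vecZ memvZ // memv_span // map_f // mem_nth.
Qed.

Lemma ext_sub_span (X : seq V) : exts <<X>> = <<map ext X>>%VS.
Proof.
apply/eqP; rewrite eqEsubv; apply/andP; split; apply/span_subvP => _ /mapP[v vX ->].
  exact/ext_vec_span/vbasis_mem.
by apply: ext_vec_span; rewrite (span_basis (vbasisP _)) memv_span.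
Qed.

Lemma mem_ext_sub U v : v \in U -> ext v \in exts U.
Proof. by move=> vU; apply: ext_vec_span; rewrite (span_basis (vbasisP U)). Qed.

Lemma ext_subS U W : (U <= W)%VS -> (exts U <= exts W)%VS.
Proof.
move/subvP=> UW; apply/span_subvP => _ /mapP[v /vbasis_mem/UW vW ->].
exact: mem_ext_sub.
Qed.

Lemma ext_subD U W : exts (U + W) = (exts U + exts W)%VS.
Proof.
rewrite -{1}(span_basis (vbasisP U)) -{1}(span_basis (vbasisP W)) -span_cat.
by rewrite ext_sub_span map_cat span_cat.
Qed.

(** The coordinates of a basis of [U] form a matrix of full row rank over [F], and the rank of a
    matrix is unchanged by extension of the field. *)
Lemma ext_sub_dim U : \dim (exts U) = \dim U.
Proof.
pose M := \matrix_(i < \dim U) rVof b (vbasis U)`_i.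
have -> : exts U = <<rows_of (map_mx iota M)>>%VS.
  rewrite /ext_sub; congr (<<_>>%VS).
  apply: (@eq_from_nth _ 0) => [|i]; rewrite size_map size_tuple.
    by rewrite size_map size_enum_ord.
  move=> iU.
  rewrite (nth_map 0) ?size_tuple // (nth_map (Ordinal iU)) ?size_enum_ord //.
  rewrite -map_row rowK ext_vecE; congr (map_mx _ (rVof _ _)).
  by rewrite nth_enum_ord.
rewrite rows_rank mxrank_map; apply/eqP; rewrite -/(row_free M) -kermx_eq0.
apply/rowV0P => u /sub_kermxP uM; apply/rowP => i; rewrite mxE.
have /freeP := basis_free (vbasisP U); apply.
apply/eqP; rewrite -(rVof_eq0 (vbasisP {:V})) linear_sum /=; apply/eqP.
rewrite -[RHS]uM mulmx_sum_row; apply: eq_bigr => j _.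
by rewrite linearZ rowK.
Qed.

Lemma ext_sub0 : exts 0 = 0%VS.
Proof. by apply/eqP; rewrite -dimv_eq0 ext_sub_dim dimv0. Qed.

Lemma ext_subf : exts fullv = fullv.
Proof. by apply/eqP; rewrite eqEdim subvf ext_sub_dim dim_rV /=. Qed.

Section Intertwined.
Variables (f : 'End(V)) (g : 'End(VK)).
Hypothesis fg : forall v, g (ext v) = ext (f v).

Lemma ext_limg U : (g @: exts U)%VS = exts (f @: U).
Proof.
rewrite -{2}(span_basis (vbasisP U)) limg_span ext_sub_span -map_comp limg_span.
rewrite -map_comp; congr (<<_>>%VS); apply: eq_map => v; exact: fg.
Qed.

(** The inclusion is an equality because the ranks, hence the nullities, agree. *)
Lemma ext_lker : lker g = exts (lker f).
Proof.
apply/esym/eqP; rewrite eqEdim; apply/andP; split.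
  apply/span_subvP => _ /mapP[v /vbasis_mem vf ->]; rewrite memv_ker fg.
  move: vf; rewrite memv_ker => /eqP ->.
  by rewrite -(scale0r 0) ext_vecZ rmorph0 scale0r.
have := limg_ker_dim g fullv; have := limg_ker_dim f fullv.
rewrite !capfv -ext_subf ext_limg !ext_sub_dim; lia.
Qed.

End Intertwined.

Lemma ext_endo (f : 'End(V)) : exists g : 'End(VK), forall v, g (ext v) = ext (f v).
Proof.
exists (linfun (mulmxr (map_mx iota (mxof b b f)))) => v.
by rewrite lfunE /= !ext_vecE -map_mxM mul_mxof rVofK ?vbasisP.
Qed.

Variables (k : nat) (d : {ffun 'I_k -> nat}).

Lemma ext_point_exists (x : tpv V d) : exists y : tpv VK d, ext_point iota x y.
Proof.
have [g fg] := ext_endo (endo x).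
pose D : filtration VK k := [ffun i => exts (flag x i)].
have DE i : fl D i = exts (fl (flag x) i) by rewrite /fl ffunE.
have h0 : is_flag d D.
  case/is_flagP: (flagP x) => h1 h2 h3 h4; apply/is_flagP; split.
  - by rewrite DE h1 ext_sub0.
  - by rewrite DE h2 ext_subf.
  - by move=> i ik; rewrite !DE ext_subS ?h3.
  - by move=> i ik; rewrite DE ext_sub_dim h4.
have h1 : [forall i, (g @: upto D i <= below D i)%VS].
  apply/forallP => i; rewrite uptoE belowE !DE (ext_limg fg) ext_subS //.
  exact: endo_fl.
have h2 : (limg g <= exts (mid x) <= lker g)%VS.
  rewrite -ext_subf (ext_limg fg) (ext_lker fg).
  by rewrite !ext_subS ?limg_mid ?mid_lker.
by exists (TPV h0 h1 h2); split=> // i; rewrite ffunE.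
Qed.

Section ExtPoint.
Variables (x : tpv V d) (y : tpv VK d).
Hypothesis xy : ext_point iota x y.

Lemma ext_point_fl i : fl (flag y) i = exts (fl (flag x) i).
Proof. by case: xy => h _ _; rewrite /fl h. Qed.

Lemma ext_point_dim_mid : \dim (mid y) = \dim (mid x).
Proof. by case: xy => _ -> _; rewrite ext_sub_dim. Qed.

Lemma ext_point_mid i :
  \dim (mid y + fl (flag y) i) = \dim (mid x + fl (flag x) i).
Proof. by rewrite ext_point_fl; case: xy => _ -> _; rewrite -ext_subD ext_sub_dim. Qed.

Lemma ext_point_endo p q :
  \dim (endo y @: fl (flag y) q + fl (flag y) p) =
  \dim (endo x @: fl (flag x) q + fl (flag x) p).
Proof.
rewrite !ext_point_fl; case: xy => _ _ h.
by rewrite (ext_limg h) -ext_subD ext_sub_dim.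
Qed.

(** The dimensions of intersections are recovered from those of sums, with which extension of
    scalars commutes. *)
Lemma ext_point_lker :
  alpha (lker (endo y)) (flag y) = alpha (lker (endo x)) (flag x).
Proof.
apply: alpha_eq => i ik; rewrite psum_alpha //; case: xy => _ _ h.
have := dimv_sum_cap (lker (endo y)) (fl (flag y) i).
have := dimv_sum_cap (lker (endo x)) (fl (flag x) i).
rewrite ext_point_fl (ext_lker h) -ext_subD !ext_sub_dim; lia.
Qed.

End ExtPoint.
End BaseChange.

(** * Dense points and components *)

Section Mid.
Local Open Scope nat_scope.
Variables (E : fieldType) (V : vectType E) (k : nat) (d : {ffun 'I_k -> nat}).
Implicit Types (x : tpv V d).

(** Trades [W :&: D_i] for [W + D_i], whose dimension is the rank of a matrix in the coordinates. *)
Lemma dim_mid_fl x i : i <= k ->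
  \dim (mid x + fl (flag x) i) + psum (alpha (mid x) (flag x)) i =
    \dim (mid x) + psum d i.
Proof. by move=> ik; rewrite psum_alpha // dimv_sum_cap fl_dim. Qed.

Lemma psum_mid_le x x1 i : i <= k -> \dim (mid x1) = \dim (mid x) ->
    \dim (mid x1 + fl (flag x1) i) <= \dim (mid x + fl (flag x) i) ->
  psum (alpha (mid x) (flag x)) i <= psum (alpha (mid x1) (flag x1)) i.
Proof. by move=> ik mE; have := dim_mid_fl x ik; have := dim_mid_fl x1 ik; lia. Qed.

Lemma dim_mid_fl_le x b i : i <= k -> alpha (mid x) (flag x) = b ->
  \dim (mid x + fl (flag x) i) <= \sum_l b l + psum d i - psum b i.
Proof.
move=> ik xb; rewrite -xb (sum_alpha (mid x) x) -(dim_mid_fl x ik).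
by rewrite addnK.
Qed.

Lemma rank_cut_arcs x b c p l q : alpha (mid x) (flag x) = b ->
    p <= l < q -> q <= k ->
    psum d p + c <= \dim (endo x @: fl (flag x) q + fl (flag x) p) ->
  c + psum b p + psum d l.+1 + psum b q <= psum b l + psum b l.+1 + psum d q.
Proof. by move=> xb plq qk; have := rank_cut xb plq qk; lia. Qed.

(** The cut bound solved for the rank, giving the constant of a closed condition. *)
Lemma rank_cut_le x b p l q : alpha (mid x) (flag x) = b -> p <= l < q -> q <= k ->
  \dim (endo x @: fl (flag x) q + fl (flag x) p) <=
    psum d p + psum b l + psum b l.+1 + psum d q -
      (psum b p + psum d l.+1 + psum b q).
Proof. by move=> xb plq qk; have := rank_cut xb plq qk; lia. Qed.

(** The numerical conditions of [match_n_surj] come from [t D_(i+1)] lying in [ker t :&: D_i], from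
    [im t] lying in [W], and from [W] lying in [ker t]. *)
Lemma lker_alpha_surj x : exists a : {ffun 'I_k -> nat},
  [/\ forall i, a i <= d i, match_n d a = alpha (lker (endo x)) (flag x) &
      \sum_i a i = \dim (mid x)].
Proof.
set n := alpha _ _.
have nE i : i <= k -> psum n i = \dim (lker (endo x) :&: fl (flag x) i).
  exact: psum_alpha.
have limgk : (limg (endo x) <= lker (endo x))%VS.
  exact: subv_trans (limg_mid x) (mid_lker x).
have kerE i : i <= k ->
    psum n i + \dim (endo x @: fl (flag x) i) = psum d i.
  by move=> ik; rewrite nE // -(fl_dim x ik) capvC limg_ker_dim.
apply: match_n_surj => [i|i||].
- exact: alpha_le.
- rewrite -(kerE i.+1 (ltn_ord i)) leq_add2l nE ?(ltnW (ltn_ord i)) // dimvS //.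
  rewrite subv_cap endo_fl // andbT; apply: subv_trans limgk; exact: limgS (subvf _).
- by rewrite -(kerE k (leqnn k)) leq_add2l flk dimvS ?limg_mid.
- by rewrite nE // flk capvf dimvS ?mid_lker.
Qed.

End Mid.

(** * Which points lie in the component *)

Section ComponentTheory.
Variables (F : fieldType) (K : closedFieldType) (iota : {rmorphism F -> K}).
Variables (V : vectType F) (k : nat) (d a : {ffun 'I_k -> nat}).
Hypothesis had : forall i, (a i <= d i)%N.
Local Notation VK := 'rV[K]_(\dim {:V}).

Lemma component_dim_mid (x : tpv V d) :
  Zcomponent a iota x -> \dim (mid x) = (\sum_i a i)%N.
Proof.
case=> y xy cy; rewrite -(ext_point_dim_mid xy).
apply: (cy _ (@closed_dim_mid _ _ _ _ _)) => z zc.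
by rewrite -(sum_alpha (mid z) z) zc.
Qed.

(** On [Z_a] the dimensions of [W + D_i] and the ranks of [t] satisfy closed upper bounds depending
    on [a] only. They persist on the closure, descend to [x], and give the two conditions of
    [rank_dominance]. *)
Lemma component_dense (a' : {ffun 'I_k -> nat}) (x : tpv V d) :
    (forall i, a' i <= d i)%N -> dense_point a' x ->
    (forall p q, (p <= k)%N -> (q <= k)%N ->
      \dim (endo x @: fl (flag x) q + fl (flag x) p) =
        psum d p + arcs_in d a' p q)%N ->
  Zcomponent a iota x -> a' = a.
Proof.
move=> had' /and3P[/eqP wx _ _] rx cx.
have mx := component_dim_mid cx; case: cx => y xy cy.
apply: (rank_dominance had').
- move=> i ik.
  pose c := (\sum_l a l + psum d i - psum a i)%N.
  have : (\dim (mid y + fl (flag y) i) <= c)%N.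
    by apply: (cy _ (@closed_mid _ _ _ _ _ c ik)) => z; apply: dim_mid_fl_le.
  rewrite (ext_point_mid xy) /c; have := dim_mid_fl x ik; rewrite wx mx.
  have : (psum a i <= psum d i)%N by have := leq_psum had (leq0n i); rewrite !psum0; lia.
  have : (psum a' i <= psum d i)%N by have := leq_psum had' (leq0n i); rewrite !psum0; lia.
  lia.
- by rewrite !psum_full // -mx -(sum_alpha (mid x) x) wx.
- move=> p l q plq qk; have pk : (p <= k)%N by lia.
  have lq : (l.+1 <= q)%N by lia.
  have pl : (p <= l)%N by lia.
  (* These inequalities show that the subtraction in [c] is not truncated. *)
  have := leq_psum had lq; have := psum_mono a pl; have := psum_mono d lq.
  have := psum_mono a lq.
  pose c := (psum d p + psum a l + psum a l.+1 + psum d q -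
    (psum a p + psum d l.+1 + psum a q))%N.
  have : (\dim (endo y @: fl (flag y) q + fl (flag y) p) <= c)%N.
    by apply: (cy _ (@closed_endo _ _ _ _ _ _ c pk qk)) => z zc; apply: rank_cut_le.
  by rewrite (ext_point_endo xy) rx // /c; lia.
Qed.

Hypothesis hV : \dim {:V} = (\sum_i d i)%N.

Lemma Yset_component (x : tpv V d) : Yset a x -> Zcomponent a iota x.
Proof.
case/andP=> /eqP kx /eqP wx.
have [y xy] := ext_point_exists iota x; exists y => //.
have ky := ext_point_lker xy; rewrite kx in ky.
have hK : \dim {:VK} = (\sum_i d i)%N by rewrite dim_rV.
have [e [eB fy ly]] := adapted_basis had hK ky.
have [x1 [f1 l1 /and3P[/eqP w1 _ _] r1]] := dense_point_of_basis eB had.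
have m1 : \dim (mid x1) = (\sum_i a i)%N by rewrite -(sum_alpha (mid x1) x1) w1.
have my : \dim (mid y) = (\sum_i a i)%N by rewrite (ext_point_dim_mid xy).
apply: (deformation_closure eB fy (x1 := x1)).
- by rewrite f1 fy.
- by rewrite l1 ly.
- by rewrite m1 my.
(* A large [W + D_i] means a small [W :&: D_i], so [a] dominates the type of [W] at [z]; the ranks
   at [z], at least those at the dense point [x1], give the cut inequalities. *)
move=> z fz mz hW hT; apply/esym; apply: (rank_dominance had).
- move=> i ik; rewrite -w1; apply: psum_mid_le => //; first by rewrite m1 mz my.
  by rewrite fz f1 -fy; apply: hW.
- by rewrite !psum_full // -my -mz; apply: sum_alpha.
- move=> p l q plq qk; have pk : (p <= k)%N by case/andP: plq; lia.
  apply: (rank_cut_arcs erefl plq qk); rewrite -(r1 p q pk qk) fz f1 -fy.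
  exact: hT.
Qed.

End ComponentTheory.

(** * The indicator function as a sum over strata *)

Section Indicator.
Variables (L : fieldType) (F : fieldType) (V : vectType F) (k : nat).
Variables (d a : {ffun 'I_k -> nat}).

Lemma sum_indic (T : eqType) (s : seq T) (u : T) : uniq s -> u \in s ->
  \sum_(w <- s) (u == w)%:R = 1 :> L.
Proof.
move=> us uin; rewrite (bigD1_seq u) //= eqxx big1 ?addr0 // => w.
by rewrite eq_sym => /negbTE->.
Qed.

(** [Y_a] is the disjoint union of the strata of kernel type [match_n d a] whose [w] has the same
    total as [a], with [r] arbitrary. *)
Lemma Yset_Tspace : Tspace (indicator L (@Yset F V k d a)).
Proof.
(* Each entry of a type is at most the corresponding [d i], hence at most [B], so [cs] is a finite
   list containing all types. *)
pose B := (\sum_i d i)%N.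
pose cs := [seq [ffun i => nat_of_ord (w i)] | w : {ffun 'I_k -> 'I_B.+1}].
have ucs : uniq cs.
  rewrite map_inj_uniq ?enum_uniq // => w w' /ffunP ww; apply/ffunP => i.
  by apply: val_inj; have := ww i; rewrite !ffunE.
have mcs X x : alpha X (flag (x : tpv V d)) \in cs.
  apply/mapP; exists [ffun i => inord (alpha X (flag x) i)]; first by rewrite mem_enum.
  apply/ffunP => i; rewrite [RHS]ffunE [in RHS]ffunE inordK // ltnS.
  by rewrite (leq_trans (alpha_le _ _ _)) // /B (bigD1 i) //= leq_addr.
pose ws := [seq w : {ffun 'I_k -> nat} <- cs | (\sum_i w i == \sum_i a i)%N].
exists [seq (1, (w, r, match_n d a)) | w <- ws, r <- cs] => x.
rewrite big_allpairs_dep /= /indicator /Yset /strat.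
set al := alpha (lker _) _; set aw := alpha (mid x) _; set ar := alpha (limg _) _.
(* Exactly one [r] in [cs] is the type of the image, so the inner sum collapses. *)
rewrite (eq_bigr (fun w => (aw == w)%:R * (al == match_n d a)%:R)) => [|w _]; last first.
  rewrite -[RHS]mulr1 -[X in _ = _ * X](sum_indic ucs (mcs (limg (endo x)) x)) big_distrr /=.
  by apply: eq_bigr => r _; rewrite /= mul1r -!natrM !mulnb -andbA [X in _ && X]andbC.
rewrite -big_distrl /= -mulnb natrM mulrC; congr (_ * _).
rewrite /ws big_filter -(sum_alpha (mid x) x) -/aw [RHS]big_mkcond -[LHS]mulr1.
rewrite -[X in _ * X](sum_indic ucs (mcs (mid x) x)) -/aw big_distrr /=.
apply: eq_bigr => w _; case: (aw =P w) => [->|_]; last by rewrite mulr0; case: ifP.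
by rewrite mulr1; case: ifP.
Qed.

End Indicator.

Theorem theorem3p3p2 (R : realType)
    (F : finFieldType)
    (K : closedFieldType) (iota : {rmorphism F -> K})
    (halg : integralRange iota)
    (k : nat) (hk : (0 < k)%N)
    (d a : {ffun 'I_k -> nat}) (had : forall i, (a i <= d i)%N)
    (D : vectType F) (hD : \dim {:D} = (\sum_i d i)%N) :
  let P (f : tpv D d -> Cq R) :=
    [/\ Tspace_s f,
        forall x, dense_point a x -> f x = 1 &
        forall x, f x != 0 -> Zcomponent a iota x] in
  P (indicator (Cq R) (Yset a)) /\
  forall f, P f -> f =1 indicator (Cq R) (Yset a).
Proof.
move=> P; have [e eB] := basis_exists hD; split.
  split; first split; first exact: Yset_Tspace.
  - by move=> x x' wx kx; rewrite /indicator /Yset wx kx.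
  - move=> x /and3P[/eqP wx _ /eqP nx].
    by rewrite /indicator /Yset nx -(sum_alpha (mid x) x) wx !eqxx.
  - move=> x; rewrite /indicator; case Yx: (Yset a x); last by rewrite eqxx.
    by move=> _; apply: Yset_component.
move=> f [[_ fs] f1 f0] x; rewrite /indicator.
have [x1 [_ _ dx1 _]] := dense_point_of_basis eB had.
have dense_lker (b : {ffun _}) (z : tpv D d) : dense_point b z -> alpha (lker (endo z)) (flag z) = match_n d b.
  by case/and3P=> _ _ /eqP->.
have dense_mid (b : {ffun _}) (z : tpv D d) : dense_point b z -> \dim (mid z) = (\sum_i b i)%N.
  by case/and3P=> /eqP zb _ _; rewrite -(sum_alpha (mid z) z) zb.
case Yx: (Yset a x).
  (* [x] and the dense point [x1] share the two invariants on which [f] depends. *)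
  case/andP: Yx => /eqP kx /eqP wx; rewrite mulr1n -(f1 x1 dx1); apply: fs.
    by rewrite wx (dense_mid _ _ dx1).
  by rewrite kx (dense_lker _ _ dx1).
(* If [f x] is nonzero, [f] is also nonzero at the standard dense point [x2] of the composition [b]
   with the same invariants; [x2] is then in the component, which forces [b = a]. *)
apply/eqP; apply: contraFT Yx => fx.
have wx := component_dim_mid (f0 x fx).
have [b [bd bn bw]] := lker_alpha_surj x.
have [x2 [_ _ dx2 rx2]] := dense_point_of_basis eB bd.
have fx2 : f x2 = f x by apply: fs; rewrite ?(dense_mid _ _ dx2) ?(dense_lker _ _ dx2).
have ba := component_dense had bd dx2 rx2 (f0 x2 _).
by rewrite /Yset -bn ba ?fx2 // wx !eqxx.
Qed.
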